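(* Let $\alpha\in(3/2,\infty]$, $\lambda>0$ and $\beta>0$. There does not exist a measurable map $\eta\mapsto\mu^\eta\in\mathcal P(\Omega_\alpha)$ such that the following two properties hold: (1) $\eta\mapsto\mu^\eta$ is a shift-covariant infinite-volume Gibbs measure for the disordered long-range Gaussian chain with parameters $(\alpha,\lambda,\beta)$; (2) it has finite annealed first moment: $\mathbb E\bigl[\mu^\eta[|\phi(0)|]\bigr]<\infty$.
   Context: Disorder: $\eta=(\eta_x)_{x\in\mathbb Z}$ is a collection of i.i.d. real random variables with $\mathbb E[\eta_x]=0$ and $\mathbb E[\eta_x^2]=1$; $\mathbb P$ denotes the law of the disorder and $\mathbb E$ its expectation. Convention for $\alpha=\infty$: $|k|^{-\infty}:=1$ if $|k|=1$ and $|k|^{-\infty}:=0$ if $|k|\ge 2$ (nearest-neighbour model). $\Omega_\alpha:=\{\phi:\mathbb Z\to\mathbb Z \mid \sum_{y\in\mathbb Z\setminus\{0\}}|y|^{-\alpha}|\phi(y)|<\infty\}$, and $\mathcal P(\Omega_\alpha)$ is the set of probability measures on $\Omega_\alpha$ (with the $\sigma$-algebra generated by the coordinates). For a measure $\mu$ and a function $f$, $\mu[f]$ denotes the expectation of $f$ under $\mu$. Finite-volume specification: for finite $\Lambda\subset\mathbb Z$, $\zeta\in\Omega_\alpha$ and $\xi\in\mathbb Z^\Lambda$, $$\mathcal H^\eta_{\Lambda,\alpha,\lambda}(\xi\mid\zeta):=\frac12\sum_{\{x,y\}\subset\Lambda,\,x\ne y}|x-y|^{-\alpha}(\xi(x)-\xi(y))^2+\frac12\sum_{x\in\Lambda}\sum_{y\notin\Lambda}|x-y|^{-\alpha}\bigl[(\xi(x)-\zeta(y))^2-\zeta(y)^2\bigr]-\lambda\sum_{x\in\Lambda}\eta_x\xi(x)$$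 (the first sum is over unordered pairs), and $$\gamma^\eta_{\Lambda,\alpha,\lambda,\beta}(\xi\mid\zeta):=\frac{\exp(-\beta\mathcal H^\eta_{\Lambda,\alpha,\lambda}(\xi\mid\zeta))}{\sum_{\xi'\in\mathbb Z^\Lambda}\exp(-\beta\mathcal H^\eta_{\Lambda,\alpha,\lambda}(\xi'\mid\zeta))}.$$ For a function $f$ of the configuration, $\gamma^\eta_{\Lambda,\alpha,\lambda,\beta}[f\mid\zeta]$ is the expectation of $f$ at the configuration equal to $\xi$ on $\Lambda$ and to $\zeta$ on $\Lambda^c$, where $\xi$ has law $\gamma^\eta_{\Lambda,\alpha,\lambda,\beta}(\cdot\mid\zeta)$. A measurable map $\eta\mapsto\mu^\eta\in\mathcal P(\Omega_\alpha)$ is a shift-covariant infinite-volume (random) Gibbs measure with parameters $(\alpha,\lambda,\beta)$ if: - (DLR) for $\mathbb P$-a.e. $\eta$, for every finite $\Lambda\subset\mathbb Z$ and every bounded local measurable function $f$, $\mu^\eta[f]=\int_{\Omega_\alpha}\gamma^\eta_{\Lambda,\alpha,\lambda,\beta}[f\mid\phi]\,\mu^\eta(d\phi)$; - (shift-covariance) for every $a\in\mathbb Z$, $\mu^{\theta_a\eta}=\mu^\eta\circ\tau_a^{-1}$ for $\mathbb P$-a.e. $\eta$, where $(\theta_a\eta)_x:=\eta_{x+a}$ and $(\tau_a\phi)(x):=\phi(x+a)$. *)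

(* Defs.v *)
From HB Require Import structures.
From mathcomp Require Import all_boot all_order all_algebra finmap.
From mathcomp Require Import all_classical all_reals all_analysis.
From mathcomp Require Import lra zify.

Set Implicit Arguments.
Unset Strict Implicit.
Unset Printing Implicit Defensive.

Import Order.TTheory GRing.Theory Num.Theory.
Import numFieldNormedType.Exports.

Local Open Scope classical_set_scope.
Local Open Scope ring_scope.

(* Sum of an absolutely summable real family over D. The value is meaningful
   only under absolute summability. *)
Definition rsum (R : realType) (T : choiceType) (D : set T) (f : T -> R) : R :=
  fine (\esum_(t in D) ((EFin \o f)^\+ t)%E -
        \esum_(t in D) ((EFin \o f)^\- t)%E)%E.

(* Generators c_i^{-1}(B), B in F, of the sigma-algebra of a family of maps. *)
Definition coord_sets (I aT rT : Type) (c : I -> aT -> rT) (F : set (set rT)) :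
    set (set aT) :=
  \bigcup_(i in [set: I]) preimage_set_system setT (c i) F.

Definition disorder_cyl (R : realType) : set (set (int -> R)) :=
  coord_sets (fun (x : int) (eta : int -> R) => eta x) measurable.
Arguments disorder_cyl : clear implicits.

(* R^Z with the product of the Borel sigma-algebras. *)
Definition disorder (R : realType) := g_sigma_algebraType (disorder_cyl R).

HB.instance Definition _ (R : realType) := Measurable.on (disorder R).

Definition eta_at (R : realType) (x : int) (eta : disorder R) : R := eta x.

Definition theta (R : realType) (a : int) (eta : disorder R) : disorder R :=
  fun x => eta (x + a).

Definition mutually_independent (I : choiceType) d d' (T : measurableType d)
    (T' : measurableType d') (R : realType) (P : probability T R)
    (X : I -> T -> T') : Prop :=
  forall (S : {fset I}) (A : I -> set T'), (forall i, measurable (A i)) ->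
    P (\bigcap_(i in [set` S]) (X i @^-1` A i)) =
    (\prod_(i <- S) P (X i @^-1` A i))%E.

Definition identically_distributed (I : Type) d d' (T : measurableType d)
    (T' : measurableType d') (R : realType) (P : probability T R)
    (X : I -> T -> T') : Prop :=
  forall (i j : I) (A : set T'), measurable A ->
    P (X i @^-1` A) = P (X j @^-1` A).

(* P is the law of an i.i.d. centred disorder of unit variance; finiteness of
   the second moment makes the first moment well defined. *)
Definition iid_disorder (R : realType) (P : probability (disorder R) R) : Prop :=
  [/\ mutually_independent P (@eta_at R),
      identically_distributed P (@eta_at R),
      forall x, ('E_P[fun eta => eta_at x eta] = 0)%E &
      forall x, ('E_P[fun eta => (eta_at x eta ^+ 2)%R] = 1)%E].

(* |k|^{-alpha}; the value alpha = +oo is the nearest-neighbour coupling, and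
   alpha = -oo is a junk case. *)
Definition coupling (R : realType) (alpha : \bar R) (k : int) : R :=
  match alpha with
  | r%:E => (`|k|%N)%:R `^ (- r)
  | _ => (`|k|%N == 1%N)%:R
  end.

Section config.
Context {R : realType}.
Variable alpha : \bar R.

Definition Omega_set : set (int -> int) :=
  [set phi : int -> int | (\esum_(y in [set y : int | y != 0%R])
               (coupling alpha y * (`|phi y|%N)%:R)%:E < +oo)%E].

Lemma coupling_ge0 (k : int) : 0 <= coupling alpha k.
Proof. by rewrite /coupling; case: alpha => [r||] //; exact: powR_ge0. Qed.

Lemma esum_finsupp_lty (D : set int) (S : {fset int}) (g : int -> R) :
  (forall y, 0 <= g y) -> (forall y, y \notin S -> g y = 0) ->
  (\esum_(y in D) (g y)%:E < +oo)%E.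
Proof.
move=> g0 gS.
apply: (@le_lt_trans _ _ (\esum_(y in [set` S]) (g y)%:E)%E).
  rewrite esum_mkcond [leRHS]esum_mkcond; apply: le_esum => y _.
  case: ifPn => _; last by case: ifPn => _ //; rewrite lee_fin.
  by case: ifPn => // /negP; rewrite in_setE /= => /negP/gS ->.
rewrite esum_fset//; last by move=> y _; rewrite lee_fin.
rewrite fsbig_finite//= sumEFin; exact: ltry.
Qed.

Lemma Omega_set0 : Omega_set (fun=> 0).
Proof. by rewrite /Omega_set /= esum1 // => y _; rewrite mulr0. Qed.

Lemma esumZ_lty (C : R) (g : int -> \bar R) :
  0 <= C -> (forall y, 0 <= g y)%E -> (\esum_(y in setT) g y < +oo)%E ->
  (\esum_(y in setT) (C%:E * g y) < +oo)%E.
Proof.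
move=> C0 g0 gfin.
apply: (@le_lt_trans _ _ (C%:E * \esum_(y in setT) g y)%E); last first.
  by rewrite lte_mul_pinfty// lee_fin.
apply: ub_ereal_sup => _ [A fA <-].
rewrite -ge0_mule_fsumr//; apply: lee_wpmul2l; first by rewrite lee_fin.
by apply: esum_ge; exists A.
Qed.

Lemma coupling_shift (r : R) (a z : int) : z != 0 -> z - a != 0 ->
  (`|z - a|%N)%:R `^ (- r) <=
  (`|a|.+1%N)%:R `^ `|r| * (`|z|%N)%:R `^ (- r) :> R.
Proof.
move=> z0 za0.
have pz : (0 < `|z|)%N by lia.
have pza : (0 < `|z - a|)%N by lia.
have h1 : (`|z - a| <= `|a|.+1 * `|z|)%N by nia.
have h2 : (`|z| <= `|a|.+1 * `|z - a|)%N by nia.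
have [r0|r0] := leP 0 r.
  rewrite ger0_norm// !powRN -[leLHS]mul1r ler_pdivrMr ?powR_gt0 ?ltr0n//.
  rewrite mulrAC ler_pdivlMr ?powR_gt0 ?ltr0n// mul1r -powRM ?ler0n//.
  by rewrite ge0_ler_powR// ?nnegrE ?ler0n -?natrM ?ler_nat.
rewrite ltr0_norm// -powRM ?ler0n//.
by rewrite ge0_ler_powR// ?nnegrE ?ler0n ?oppr_ge0 ?(ltW r0) -?natrM ?ler_nat.
Qed.

Lemma Omega_set_shift (a : int) (phi : int -> int) :
  Omega_set phi -> Omega_set (fun x => phi (x + a)).
Proof.
rewrite /Omega_set /= => hphi.
have ninf : (forall k, coupling alpha k = (`|k|%N == 1%N)%:R) ->
    (\esum_(y in [set y : int | y != 0%R])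
      (coupling alpha y * (`|phi (y + a)%R|%N)%:R)%:E < +oo)%E.
  move=> h; apply: (@esum_finsupp_lty _ [fset (1 : int); (-1 : int)]%fset) => y.
    by rewrite mulr_ge0 ?coupling_ge0.
  rewrite h !inE => hy; case: eqP => [|_]; last by rewrite mul0r.
  by move: hy; lia.
case: (alpha) hphi ninf => [r||] hphi ninf; try by apply: ninf.
pose C : R := (`|a|.+1%N)%:R `^ `|r|.
pose t (y : int) : R := (`|y|%N)%:R `^ (- r) * (`|phi (y + a)%R|%N)%:R.
pose u (z : int) : \bar R := (coupling r%:E z * (`|phi z|%N)%:R)%:E.
have u0 z : (0 <= u z)%E by rewrite lee_fin mulr_ge0 ?powR_ge0.
pose v (z : int) : \bar R := if z != 0 then u z else 0%E.
have v0 z : (0 <= v z)%E by rewrite /v; case: ifP.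
have t0 y : 0 <= t y by rewrite mulr_ge0 ?powR_ge0.
pose s (y : int) : R := if y == - a then t y else 0.
have s0 y : 0 <= s y by rewrite /s; case: ifP.
apply: (@le_lt_trans _ _
    (\esum_(y in [set: int]) ((s y)%:E + C%:E * v (y + a)%R)%E)%E).
  rewrite [leLHS]esum_mkcond; apply: le_esum => y _; case: ifPn; last first.
    by move=> _; rewrite adde_ge0 ?lee_fin// mule_ge0// lee_fin powR_ge0.
  rewrite in_setE /= => y0; rewrite /s /v; case: eqVneq => [->|ya].
    by rewrite /t addNr eqxx /= mule0 adde0.
  have za : y + a != 0 by move: ya; lia.
  rewrite za add0e /u -EFinM lee_fin /= mulrA; apply: ler_wpM2r => //.
  by have := @coupling_shift r a (y + a) za; rewrite addrK; apply.
rewrite esumD; last 2 first.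
- by move=> y _; rewrite lee_fin.
- by move=> y _; rewrite mule_ge0// lee_fin powR_ge0.
apply: lte_add_pinfty.
  apply: (@esum_finsupp_lty _ [fset (- a : int)]%fset) => // y.
  by rewrite inE /s => /negPf ->.
apply: esumZ_lty; [exact: powR_ge0|by move=> y|].
have -> : (\esum_(y in [set: int]) v (y + a)%R = \esum_(z in [set: int]) v z)%E.
  rewrite [RHS](@reindex_esum _ _ _ setT setT (fun y : int => y + a))//.
  split => //.
  - by move=> x y _ _ /addIr.
  - by move=> z _; exists (z - a) => //; rewrite subrK.
have -> // : (\esum_(z in [set: int]) v z =
  \esum_(y in [set y : int | y != 0%R]) u y)%E.
rewrite [RHS]esum_mkcond; apply: eq_esum => z _.
by rewrite /v mem_setE.
Qed.

(* The configuration equal to xi on Lambda and to zeta off Lambda. *)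
Definition glue_fun (Lambda : {fset int}) (xi : {ffun Lambda -> int})
    (zeta : int -> int) : int -> int :=
  fun x => if insub x is Some x' then xi x' else zeta x.

Lemma Omega_set_glue (Lambda : {fset int}) (xi : {ffun Lambda -> int})
    (zeta : int -> int) : Omega_set zeta -> Omega_set (glue_fun xi zeta).
Proof.
rewrite /Omega_set /= => hz.
pose t (y : int) : R := coupling alpha y * (`|glue_fun xi zeta y|%N)%:R.
have t0 y : 0 <= t y by rewrite mulr_ge0 ?coupling_ge0.
pose s (y : int) : R := if y \in Lambda then t y else 0.
have s0 y : 0 <= s y by rewrite /s; case: ifP.
pose u (z : int) : \bar R := (coupling alpha z * (`|zeta z|%N)%:R)%:E.
have u0 z : (0 <= u z)%E by rewrite lee_fin mulr_ge0 ?coupling_ge0.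
apply: (@le_lt_trans _ _
    (\esum_(y in [set y : int | y != 0%R]) ((s y)%:E + u y)%E)%E).
  apply: le_esum => y _; rewrite -[X in (X <= _)%E]/(t y)%:E /s.
  case: ifPn => [_|yL]; first by rewrite leeDl.
  by rewrite add0e /t /glue_fun insubN.
rewrite esumD//; last by move=> y _; rewrite lee_fin.
apply: lte_add_pinfty => //.
by apply: (@esum_finsupp_lty _ Lambda) => // y yL; rewrite /s (negPf yL).
Qed.

Definition Omega_type := {phi : int -> int | Omega_set phi}.

Definition phi_at (x : int) (phi : Omega_type) : int := sval phi x.

Definition Omega_cyl : set (set Omega_type) := coord_sets phi_at setT.

End config.
Arguments Omega_set {R}.
Arguments Omega_type {R}.
Arguments Omega_cyl {R}.

HB.instance Definition _ (R : realType) (alpha : \bar R) :=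
  gen_eqMixin (Omega_type alpha).
HB.instance Definition _ (R : realType) (alpha : \bar R) :=
  gen_choiceMixin (Omega_type alpha).
HB.instance Definition _ (R : realType) (alpha : \bar R) :=
  isPointed.Build (Omega_type alpha) (exist _ _ (Omega_set0 alpha)).

(* Omega_alpha with the sigma-algebra generated by the coordinates. *)
Definition Omega (R : realType) (alpha : \bar R) :=
  g_sigma_algebraType (Omega_cyl alpha).

HB.instance Definition _ (R : realType) (alpha : \bar R) :=
  Measurable.on (Omega alpha).

Section gibbs.
Context {R : realType} {alpha : \bar R}.
Implicit Types (Lambda : {fset int}) (eta : disorder R) (phi zeta : Omega alpha).

Definition tau (a : int) phi : Omega alpha :=
  exist _ _ (Omega_set_shift a (svalP phi)).

Definition glue Lambda (xi : {ffun Lambda -> int}) zeta : Omega alpha :=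
  exist _ _ (Omega_set_glue xi (svalP zeta)).

(* The first sum runs over unordered pairs of Lambda, listed as x < y. The
   second is an absolutely convergent series, as zeta is in Omega_alpha. *)
Definition hamiltonian (lambda : R) eta Lambda
    (xi : {ffun Lambda -> int}) zeta : R :=
  2^-1 * (\sum_(x : Lambda) \sum_(y : Lambda | val x < val y)
            coupling alpha (val x - val y) * (xi x - xi y)%:~R ^+ 2)
  + 2^-1 * (\sum_(x : Lambda) rsum (~` [set` Lambda]) (fun y : int =>
            coupling alpha (val x - y) *
              ((xi x - phi_at y zeta)%:~R ^+ 2 - (phi_at y zeta)%:~R ^+ 2)))
  - lambda * \sum_(x : Lambda) eta_at (val x) eta * (xi x)%:~R.

Definition boltzmann (lambda beta : R) eta Lambda
    (xi : {ffun Lambda -> int}) zeta : R :=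
  expR (- beta * hamiltonian lambda eta xi zeta).

Definition gamma (lambda beta : R) eta Lambda
    (xi : {ffun Lambda -> int}) zeta : R :=
  boltzmann lambda beta eta xi zeta /
  rsum [set: {ffun Lambda -> int}]
    (fun xi' => boltzmann lambda beta eta xi' zeta).

Definition gammaE (lambda beta : R) eta Lambda (f : Omega alpha -> R) zeta : R :=
  rsum [set: {ffun Lambda -> int}]
    (fun xi => gamma lambda beta eta xi zeta * f (glue xi zeta)).

Definition local_fun (f : Omega alpha -> R) : Prop :=
  exists Delta : {fset int}, forall phi psi : Omega alpha,
    (forall x, x \in Delta -> phi_at x phi = phi_at x psi) -> f phi = f psi.

Definition DLR (lambda beta : R) (P : probability (disorder R) R)
    (mu : disorder R -> pprobability (Omega alpha) R) : Prop :=
  {ae P, forall eta, forall (Lambda : {fset int}) (f : Omega alpha -> R),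
    measurable_fun [set: Omega alpha] f -> bounded_fun f -> local_fun f ->
    (\int[mu eta]_phi (f phi)%:E =
     \int[mu eta]_phi (gammaE lambda beta eta Lambda f phi)%:E)%E}.

Definition shift_covariant (P : probability (disorder R) R)
    (mu : disorder R -> pprobability (Omega alpha) R) : Prop :=
  forall a : int, {ae P, forall eta, forall A : set (Omega alpha),
    measurable A -> mu (theta a eta) A = pushforward (mu eta) (tau a) A}.

Definition shift_covariant_gibbs (lambda beta : R)
    (P : probability (disorder R) R)
    (mu : disorder R -> pprobability (Omega alpha) R) : Prop :=
  DLR lambda beta P mu /\ shift_covariant P mu.

Definition finite_annealed_first_moment (P : probability (disorder R) R)
    (mu : disorder R -> pprobability (Omega alpha) R) : Prop :=
  (\int[P]_eta \int[mu eta]_phi (`|phi_at 0 phi|%:~R)%:E < +oo)%E.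

End gibbs.

(* Main.v *)
Require Import Defs.
From mathcomp Require Import all_boot all_order all_algebra finmap.
From mathcomp Require Import all_classical all_reals all_analysis.
(* Imported last because [all_analysis] masks its measurable structure on
   [\bar R]. *)
From mathcomp Require Import measurable_realfun.
From mathcomp Require Import ring lra zify.

(** Raise the configuration by [s = 1] or [s = -1] on a box of [n] sites, and let
    [Delta] be the resulting change of energy. The sum over integer
    configurations of the box is invariant under this shift, so
    [exp(- beta * Delta)] has mean 1 under the finite-volume measure, and
    [1 + x <= exp x] shows that [Delta] has nonnegative mean. Moreover
    [Delta <= G + c / 2 - lambda * s * S], where [S] is the sum of the disorder
    over the box, [c] the sum of the couplings across its boundary, and [G] the
    sum of [J(x - y) |phi x - phi y|] over the same pairs. Hence, by DLR,
    [lambda * |S| <= mu^eta[G] + c / 2] for almost every [eta]. Averaging over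
    the disorder, shift-covariance bounds the right-hand side by
    [(2 * M + 1 / 2) * c], where [M] is the annealed first moment. For
    [alpha > 3 / 2] one has [c = O(n^(1 - theta))] with some [theta > 1 / 2],
    while [E|S|] is at least of order [sqrt n]. *)

Set Implicit Arguments.
Unset Strict Implicit.
Unset Printing Implicit Defensive.

Import Order.TTheory GRing.Theory Num.Theory.
Import numFieldNormedType.Exports.

Local Open Scope classical_set_scope.
Local Open Scope ring_scope.

(** * Countable sums *)

(** The threshold 3/2 compares two growth rates: for [1 < alpha < 2] the couplings across the
    boundary of a box of [n] sites add up to order [n^(2 - alpha)], and this is of smaller order
    than [sqrt n] exactly when [alpha > 3/2]. A first moment of the field suffices because a unit
    raise changes a squared height difference only by a term linear in that difference. Two
    obstacles shape the argument. The function [G] is neither bounded nor local, so the DLR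
    equations do not apply to it directly; it is cut into countably many bounded local nonnegative
    pieces, which are summed again by monotone convergence. Moreover, convergence of the partition
    function is not established beforehand: the effect of the raise is stated as an inequality
    between nonnegative sums over configurations, weighted by the total mass of the finite-volume
    measure. This mass is at most 1, and the DLR equation for the constant 1 shows that its mean is
    1. *)

Section countable_sums.
Context {R : realType} {T : countType}.
Local Open Scope ereal_scope.
Implicit Types (D : set T) (a : T -> \bar R).

Lemma esum_pickle a : (forall t, 0 <= a t) ->
  \esum_(t in [set: T]) a t = \sum_(n <oo) oapp a 0 (pickle_inv n : option T).
Proof.
move=> a0.
have b0 n : 0 <= oapp a 0 (pickle_inv n : option T) by case: pickle_inv => /=.
rewrite nneseries_esumT//.
rewrite (esumID (@choice.pickle T @` setT))// [X in _ + X]esum1 => [|n [_ nT]].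
  rewrite adde0 setTI esum_image; last by move=> x y _ _ /(pcan_inj choice.pickleK).
  by apply: eq_esum => t _; rewrite pickleK_inv.
case E: (pickle_inv n : option T) => [t|//]; case: nT; exists t => //.
by have := @pickle_invK T n; rewrite E.
Qed.

Lemma esumZl D a (r : R) : (0 <= r)%R -> (forall t, 0 <= a t) ->
  \esum_(t in D) (r%:E * a t) = r%:E * \esum_(t in D) a t.
Proof.
move=> r0 a0; rewrite esum_mkcond [in RHS]esum_mkcond.
have m0 t : 0 <= (if t \in D then a t else 0) by case: ifP.
rewrite !esum_pickle//; last first.
  by move=> t; case: ifP => // _; rewrite mule_ge0// lee_fin.
rewrite -nneseriesZl//; last by move=> n _; case: pickle_inv => /=.
by apply: eq_eseriesr => n _; case: pickle_inv => [t|] /=; [case: ifP|]; rewrite ?mule0.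
Qed.

Lemma esumZr D a (r : R) : (0 <= r)%R -> (forall t, 0 <= a t) ->
  \esum_(t in D) (a t * r%:E) = (\esum_(t in D) a t) * r%:E.
Proof.
move=> r0 a0; rewrite muleC -esumZl//.
by apply: eq_esum => t _; rewrite muleC.
Qed.

Context d (X : measurableType d).
Variables (D : set T) (f : T -> X -> \bar R).
Hypotheses (f0 : forall t x, 0 <= f t x)
  (mf : forall t, measurable_fun [set: X] (f t)).

Let g (n : nat) (x : X) : \bar R :=
  oapp (fun t => if t \in D then f t x else 0) 0 (pickle_inv n : option T).

Let g0 n x : 0 <= g n x.
Proof. by rewrite /g; case: pickle_inv => //= t; case: ifP. Qed.

Let mg n : measurable_fun [set: X] (g n).
Proof.
rewrite /g; case: pickle_inv => [t|] /=; last exact: measurable_cst.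
by case: (t \in D); [exact: mf|exact: measurable_cst].
Qed.

Let esum_g x : \esum_(t in D) f t x = \sum_(n <oo) g n x.
Proof. by rewrite esum_mkcond esum_pickle// => t; case: ifP. Qed.

Lemma measurable_esum : measurable_fun [set: X] (fun x => \esum_(t in D) f t x).
Proof.
under eq_fun do rewrite esum_g.
by apply: ge0_emeasurable_sum => // n x _ _; exact: g0.
Qed.

Lemma integral_esum (m : {measure set X -> \bar R}) :
  \int[m]_x (\esum_(t in D) f t x) = \esum_(t in D) \int[m]_x f t x.
Proof.
under eq_integral do rewrite esum_g.
rewrite integral_nneseries//.
rewrite [in RHS]esum_mkcond esum_pickle; last first.
  by move=> t; case: ifP => // _; exact: integral_ge0.
apply: eq_eseriesr => n _; rewrite /g; case: pickle_inv => [t|] /=.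
  by case: ifP => // _; rewrite integral0.
by rewrite integral0.
Qed.

End countable_sums.

Section rsum_theory.
Context {R : realType} {T : choiceType}.
Implicit Types (D : set T) (f g : T -> R).

Definition rsummable D f := (\esum_(t in D) `|f t|%:E < +oo)%E.

Lemma rsummable_le D f g : (forall t, D t -> `|f t| <= `|g t|) ->
  rsummable D g -> rsummable D f.
Proof.
by move=> fg; apply: le_lt_trans; apply: le_esum => t Dt; rewrite lee_fin fg.
Qed.

Lemma rsummableD D f g : rsummable D f -> rsummable D g ->
  rsummable D (fun t => f t + g t).
Proof.
move=> hf hg; apply: (@le_lt_trans _ _
  (\esum_(t in D) (`|f t|%:E + `|g t|%:E))%E).
  by apply: le_esum => t _; rewrite -EFinD lee_fin ler_normD.
by rewrite esumD; [exact: lte_add_pinfty|..] => t _; rewrite lee_fin.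
Qed.

Lemma rsum_ge0 D f : (forall t, D t -> 0 <= f t) ->
  rsum D f = fine (\esum_(t in D) (f t)%:E).
Proof.
move=> f0; rewrite /rsum [X in (_ - X)%E]esum1 ?sube0.
  congr fine; apply: eq_esum => t Dt; rewrite funeposE/=.
  by apply/max_idPl; rewrite lee_fin f0.
move=> t Dt; rewrite funenegE/=; apply/max_idPr.
by rewrite lee_fin oppr_le0 f0.
Qed.

Lemma rsummable_fin_num D f : (forall t, D t -> 0 <= f t) -> rsummable D f ->
  (\esum_(t in D) (f t)%:E)%E \is a fin_num.
Proof.
move=> f0 sf; rewrite ge0_fin_numE; last by apply: esum_ge0 => t /f0.
by apply: le_lt_trans sf; apply: le_esum => t _; rewrite lee_fin ler_norm.
Qed.

Lemma rsumB D f g : (forall t, D t -> 0 <= f t) -> (forall t, D t -> 0 <= g t) ->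
  rsummable D f -> rsummable D g ->
  rsum D (fun t => f t - g t) =
  fine (\esum_(t in D) (f t)%:E) - fine (\esum_(t in D) (g t)%:E).
Proof.
move=> f0 g0 sf sg.
rewrite -fineB ?rsummable_fin_num// /rsum; congr fine.
by have := @esumB R T D (EFin \o f) (EFin \o g); apply.
Qed.

Lemma rsumD D f g : rsummable D f -> rsummable D g ->
  rsum D (fun t => f t + g t) = rsum D f + rsum D g.
Proof.
move=> sf sg.
pose p (h : T -> R) t := Num.max (h t) 0; pose n (h : T -> R) t := Num.max (- h t) 0.
have p0 h t : 0 <= p h t by rewrite le_max lexx orbT.
have n0 h t : 0 <= n h t by rewrite le_max lexx orbT.
have ps h : rsummable D h -> rsummable D (p h).
  apply: rsummable_le => t _; rewrite ger0_norm// /p.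
  by rewrite ge_max normr_ge0 ler_norm.
have ns h : rsummable D h -> rsummable D (n h).
  apply: rsummable_le => t _; rewrite ger0_norm// /n.
  by rewrite ge_max normr_ge0 andbT -normrN ler_norm.
have E h t : h t = p h t - n h t.
  by rewrite /p /n; case: (lerP 0 (h t)) => h0; case: lerP => h1; lra.
have rE h : rsummable D h -> rsum D h =
    fine (\esum_(t in D) (p h t)%:E) - fine (\esum_(t in D) (n h t)%:E).
  by move=> sh; rewrite -rsumB//; [congr rsum; apply/funext|exact: ps|exact: ns].
(* In general [p f + p g] and [n f + n g] are not the positive and negative parts of [f + g];
   [rsumB] accepts any difference of nonnegative summable families. *)
have -> : (fun t => f t + g t) = (fun t => (p f t + p g t) - (n f t + n g t)).
  by apply/funext => t; rewrite (E f) (E g); ring.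
rewrite rsumB//; try by [move=> t _; rewrite addr_ge0|
  apply: rsummableD; [exact: ps|exact: ps]|apply: rsummableD; [exact: ns|exact: ns]].
rewrite !rE//.
under eq_esum do rewrite EFinD; under [X in _ - fine X]eq_esum do rewrite EFinD.
rewrite !esumD; try by move=> t _; rewrite lee_fin.
rewrite !fineD; try by [apply: rsummable_fin_num => //; exact: ps|
  apply: rsummable_fin_num => //; exact: ns].
by ring.
Qed.

Lemma rsum_le_norm D f : rsummable D f ->
  rsum D f <= fine (\esum_(t in D) `|f t|%:E).
Proof.
move=> sf; rewrite /rsum.
have fp : (\esum_(t in D) (EFin \o f)^\+ t <= \esum_(t in D) `|f t|%:E)%E.
  apply: le_esum => t _; rewrite funeposE/= ge_max lee_fin ler_norm/=.
  by rewrite lee_fin.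
have fn : (\esum_(t in D) (EFin \o f)^\- t <= \esum_(t in D) `|f t|%:E)%E.
  apply: le_esum => t _; rewrite funenegE/= ge_max lee_fin -normrN ler_norm/=.
  by rewrite lee_fin.
have p0 : (0 <= \esum_(t in D) (EFin \o f)^\+ t)%E by apply: esum_ge0.
have n0 : (0 <= \esum_(t in D) (EFin \o f)^\- t)%E by apply: esum_ge0.
have pf : (\esum_(t in D) (EFin \o f)^\+ t)%E \is a fin_num.
  by rewrite ge0_fin_numE// (le_lt_trans fp).
have nf : (\esum_(t in D) (EFin \o f)^\- t)%E \is a fin_num.
  by rewrite ge0_fin_numE// (le_lt_trans fn).
rewrite fineB// lerBlDr ler_wpDr ?fine_ge0//.
by apply: fine_le; rewrite // ge0_fin_numE// (le_trans p0).
Qed.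

End rsum_theory.

(** * Independence and partial sums of the disorder *)

Section disorder_measurability.
Context {R : realType}.

Lemma measurable_eta_at x : measurable_fun [set: disorder R] (@eta_at R x).
Proof.
move=> _ A mA; apply: sub_sigma_algebra.
by exists x => //; exists A.
Qed.

Lemma measurable_to_disorder d (X : measurableType d) (f : X -> disorder R) :
  (forall x, measurable_fun [set: X] (fun w => eta_at x (f w))) ->
  measurable_fun [set: X] f.
Proof.
move=> mf; apply: (@measurability _ _ X (disorder R) setT f (disorder_cyl R)) => //.
move=> _ [_ [x _ [A mA <-]] <-]; rewrite !setTI.
rewrite -[X in measurable X]setTI; exact: mf.
Qed.

Definition cylinder (S : {fset int}) (A : int -> set R) : set (disorder R) :=
  \bigcap_(i in [set` S]) (@eta_at R i @^-1` A i).

Lemma measurable_cylinder S A : (forall i, measurable (A i)) ->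
  measurable (cylinder S A).
Proof.
move=> mA; apply: fin_bigcap_measurable => // i _.
by rewrite -[X in measurable X]setTI; exact: measurable_eta_at.
Qed.

Lemma cylinder_unique (m1 m2 : {measure set (disorder R) -> \bar R}) :
  (m1 setT < +oo)%E ->
  (forall S A, (forall i, measurable (A i)) ->
    m1 (cylinder S A) = m2 (cylinder S A)) ->
  forall C, measurable C -> m1 C = m2 C.
Proof.
move=> fin1 m12 C mC.
pose G := [set C | exists S A, (forall i, measurable (A i)) /\ C = cylinder S A].
apply: (@measure_unique _ _ _ G (fun=> setT)) => //.
- apply/seteqP; split; apply: smallest_sub => //.
  + move=> _ [x _ [A mA <-]]; apply: sub_sigma_algebra.
    exists [fset x]%fset, (fun=> A); split => //.
    apply/seteqP; split => [eta [_ eA] i|eta /(_ x)].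
      by rewrite /= inE => /eqP ->.
    by rewrite /= inE eqxx => /(_ isT).
  + exact: sigma_algebra_measurable.
  + by move=> _ [S [A [mA ->]]]; exact: measurable_cylinder.
(* Stability under intersection: both cylinders are read on the union of their index sets, with the
   whole line at the missing coordinates. *)
- move=> _ _ [S [A [mA ->]]] [S' [A' [mA' ->]]].
  exists (S `|` S')%fset, (fun i => (if i \in S then A i else setT) `&`
    (if i \in S' then A' i else setT)); split.
    by move=> i; apply: measurableI; case: ifP.
  apply/seteqP; split => [eta [h h'] i _|eta h].
    by split; case: ifPn => // iS; [exact: h|exact: h'].
  split => i iS; have := h i; rewrite /= inE iS ?orbT => /(_ isT)[].
    by [].
  by [].
- move=> _; exists fset0, (fun=> setT); split => //.
  by apply/seteqP; split.
- by rewrite bigcup_const.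
- by move=> _ [S [A [mA ->]]]; exact: m12.
Qed.

Lemma disorder_law_unique d (X : measurableType d)
    (m : {measure set X -> \bar R}) (Q : probability (disorder R) R)
    (f : X -> disorder R) : measurable_fun [set: X] f ->
  (forall S A, (forall i, measurable (A i)) ->
    m (f @^-1` cylinder S A) = Q (cylinder S A)) ->
  forall C, measurable C -> m (f @^-1` C) = Q C.
Proof.
move=> mf mQ C mC; apply/esym.
apply: (@cylinder_unique Q (pushforward m f)) => //.
  by apply: (@le_lt_trans _ _ 1%E); [exact: (@probability_le1 _ _ _ Q)|exact: ltry].
by move=> S A mA; exact/esym/mQ.
Qed.

Lemma measurable_theta a : measurable_fun [set: disorder R] (@theta R a).
Proof. by apply: measurable_to_disorder => x; exact: measurable_eta_at. Qed.

(** Resampling of coordinate [k] from a second copy of the disorder. Under [P \x P] the result has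
    law [P] again, so independence of one coordinate from all the others becomes Fubini's
    theorem. *)
Definition splice (k : int) (w : disorder R * disorder R) : disorder R :=
  fun x => if x == k then w.2 x else w.1 x.

Lemma measurable_splice k :
  measurable_fun [set: disorder R * disorder R] (splice k).
Proof.
apply: measurable_to_disorder => x; rewrite /eta_at /splice.
by case: eqP => _; [have := @measurableT_comp _ _ _ _ _ _ _ _ _
  (measurable_eta_at x) (@measurable_snd _ _ _ _)|
 have := @measurableT_comp _ _ _ _ _ _ _ _ _
  (measurable_eta_at x) (@measurable_fst _ _ _ _)]; apply.
Qed.

End disorder_measurability.

Section iid.
Context {R : realType} (P : probability (disorder R) R).
Hypothesis hP : iid_disorder P.
Let indep : mutually_independent P (@eta_at R). Proof. by case: hP. Qed.
Let ident : identically_distributed P (@eta_at R). Proof. by case: hP. Qed.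

Lemma iid_cylinder S A : (forall i, measurable (A i)) ->
  P (cylinder S A) = (\prod_(i <- S) P (@eta_at R 0 @^-1` A i))%E.
Proof.
move=> mA; rewrite /cylinder indep//; apply: eq_bigr => i _.
exact: (ident i 0).
Qed.

Lemma theta_stationary a C : measurable C -> P (theta a @^-1` C) = P C.
Proof.
move=> mC; apply: disorder_law_unique C mC; first exact: measurable_theta.
move=> S A mA.
pose S' : {fset int} := [fset (i + a)%R | i in S]%fset.
have -> : theta a @^-1` cylinder S A = cylinder S' (fun i => A (i - a)).
  apply/seteqP; split => eta h i /=.
    by case/imfsetP => j /= jS ->; rewrite addrK; exact: h.
  move=> iS; have := h (i + a); rewrite /= addrK; apply.
  by apply/imfsetP; exists i.
rewrite [LHS]iid_cylinder// [RHS]iid_cylinder//.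
rewrite (perm_big [seq i + a | i <- enum_fset S])/=.
  by rewrite big_map; apply: eq_bigr => i _; rewrite addrK.
apply: uniq_perm; [exact: fset_uniq|by rewrite map_inj_uniq ?fset_uniq// => ? ? /addIr|].
move=> i; apply/imfsetP/mapP => /= -[j jS ->]; by exists j.
Qed.

(** It suffices to treat cylinders. The preimage of a cylinder over [S] is a rectangle: the
    coordinates of [S] other than [k] constrain the first copy, and [k], if it lies in [S], the
    second. *)
Lemma splice_law k C : measurable C -> (P \x P)%E (splice k @^-1` C) = P C.
Proof.
move=> mC; apply: disorder_law_unique C mC; first exact: measurable_splice.
move=> S A mA.
have -> : splice k @^-1` cylinder S A =
    cylinder (S `\ k)%fset A `*` cylinder (S `&` [fset k])%fset A.
  apply/seteqP; split => [[e e'] h|[e e'] [/= h h'] i /= iS].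
    split => i /=; rewrite !inE.
      by move=> /andP[ik iS]; have := h i iS; rewrite /splice /eta_at/= (negPf ik).
    by move=> /andP[iS ik]; have := h i iS; rewrite /splice /eta_at/= ik.
  rewrite /eta_at /splice; case: eqVneq => ik /=.
    by apply: h'; rewrite /= !inE iS ik eqxx.
  by apply: h; rewrite /= !inE iS ik.
transitivity (P (cylinder (S `\ k)%fset A) * P (cylinder (S `&` [fset k])%fset A))%E.
  by apply: product_measure1E; exact: measurable_cylinder.
rewrite !iid_cylinder// [RHS](big_fsetID _ (fun i => i != k))/=.
congr (_ * _)%E; apply: eq_fbigl => i; rewrite !inE/= ?negbK andbC//.
Qed.

(** After composition with [splice k], [F] sees only the first copy and [g] only the second, so the
    integral over the product factorizes. [F] may depend on infinitely many coordinates. *)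
Lemma expectation_splice (k : int) (F : disorder R -> R) (g : R -> R) :
  (forall e e' : disorder R, (forall x, x != k -> e x = e' x) -> F e = F e') ->
  measurable_fun [set: R] g ->
  P.-integrable [set: disorder R] (EFin \o F) ->
  P.-integrable [set: disorder R] (EFin \o (g \o eta_at k)) ->
  P.-integrable [set: disorder R] (EFin \o (fun e => F e * g (eta_at k e))) /\
  \int[P]_e (F e * g (eta_at k e)) =
    \int[P]_e F e * \int[P]_e g (eta_at k e).
Proof.
move=> Fk mg iF ig.
pose h e := (F e * g (eta_at k e))%:E.
have mF : measurable_fun setT F by apply/measurable_EFinP/measurable_int/iF.
have mgk : measurable_fun setT (g \o eta_at k).
  by apply/measurable_EFinP/measurable_int/ig.
have mh : measurable_fun setT h.
  by apply/measurable_EFinP; exact: measurable_funM.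
have hE w : (h \o splice k) w = ((F w.1)%:E * (g (eta_at k w.2))%:E)%E.
  rewrite /h /= EFinM; congr (_%:E * _)%E; last by rewrite /eta_at /splice eqxx.
  by apply: Fk => x xk; rewrite /splice (negPf xk).
have mhs : measurable_fun setT (h \o splice k).
  by apply: measurableT_comp => //; exact: measurable_splice.
have fin (G : disorder R -> R) : P.-integrable setT (EFin \o G) ->
    (\int[P]_x `|(G x)%:E|)%E \is a fin_num.
  by move=> /integrableP[_ iG]; rewrite ge0_fin_numE// integral_ge0.
have ihs : (P \x P)%E.-integrable setT (h \o splice k).
  apply/integrable12ltyP => //=.
  have -> : (fun x => \int[P]_y `|(h \o splice k) (x, y)|)%E =
      (fun x => `|(F x)%:E| * \int[P]_y `|(g (eta_at k y))%:E|)%E.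
    apply/funext => x; under eq_integral => y _ do rewrite hE abseM.
    rewrite /= ge0_integralZl//; apply/measurable_EFinP; exact: measurableT_comp.
  rewrite -(fineK (fin _ ig)) ge0_integralZr//; last 2 first.
  - by apply: measurableT_comp => //; apply/measurable_EFinP.
  - by rewrite lee_fin fine_ge0// integral_ge0.
  by rewrite -(fineK (fin _ iF)) -EFinM ltry.
have PE : (pushforward (P \x P)%E (splice k)).-integrable setT h.
  apply: integrable_pushforward => //; exact: measurable_splice.
have PP (f : disorder R -> \bar R) :
    (\int[P]_x f x = \int[pushforward (P \x P)%E (splice k)]_x f x)%E.
  apply: eq_measure_integral; first exact: measurable_splice.
  by move=> mf A mA _; rewrite /= /pushforward splice_law.
split.
  have /integrableP[_ h1] := PE; apply/integrableP; split => //.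
  by rewrite PP.
rewrite /Rintegral PP integral_pushforward//; last exact: measurable_splice.
rewrite preimage_setT -integral12_prod_meas1//=.
rewrite (_ : (fun x => \int[P]_y (h \o splice k) (x, y))%E =
    (fun x => (F x)%:E * \int[P]_y (g (eta_at k y))%:E)%E);
  last first.
  by apply/funext => x; under eq_integral => y _ do rewrite hE; rewrite /= integralZl.
have fin' (G : disorder R -> R) : P.-integrable setT (EFin \o G) ->
    (\int[P]_x (G x)%:E)%E \is a fin_num by move=> iG; exact: integrable_fin_num.
rewrite -(fineK (fin' _ ig)) integralZr//.
by rewrite -(fineK (fin' _ iF)).
Qed.

End iid.

Section partial_sums.
Context {R : realType} (P : probability (disorder R) R).
Hypothesis hP : iid_disorder P.

Definition partial_sum (n : nat) (e : disorder R) : R :=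
  \sum_(i < n) eta_at (Posz i) e.

(* Real and imaginary parts of [\prod_(i < n) (1 + 'i t h (eta_i))]. *)
Fixpoint riesz (t : R) (h : R -> R) (n : nat) (e : disorder R) : R * R :=
  if n is m.+1 then
    let z := riesz t h m e in
    let u := t * h (eta_at (Posz m) e) in
    (z.1 - z.2 * u, z.2 + z.1 * u)
  else (1, 0).

Let L1 (f : disorder R -> R) := P.-integrable [set: disorder R] (EFin \o f).
Let E (f : disorder R -> R) := \int[P]_e f e.

(** Adaptedness to the first [n] disorder variables, stated pointwise so that no filtration or
    conditional expectation is involved. *)
Definition past (T : Type) (n : nat) (f : disorder R -> T) :=
  forall e e' : disorder R, (forall i : nat, (i < n)%N -> e (Posz i) = e' (Posz i)) ->
  f e = f e'.

Let intD f g : L1 f -> L1 g -> L1 (fun e => f e + g e).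
Proof. exact: integrableD. Qed.

Let intB f g : L1 f -> L1 g -> L1 (fun e => f e - g e).
Proof. exact: integrableB. Qed.

Let intZ c f : L1 f -> L1 (fun e => c * f e).
Proof. exact: integrableZl. Qed.

Let ED f g : L1 f -> L1 g -> E (fun e => f e + g e) = E f + E g.
Proof. by move=> ? ?; rewrite /E RintegralD. Qed.

Let EB f g : L1 f -> L1 g -> E (fun e => f e - g e) = E f - E g.
Proof. by move=> ? ?; rewrite /E RintegralB. Qed.

Let EZ c f : L1 f -> E (fun e => c * f e) = c * E f.
Proof. by move=> ?; rewrite /E RintegralZl. Qed.

Let E_past n f (g : R -> R) : past n f -> measurable_fun [set: R] g ->
  L1 f -> L1 (g \o eta_at (Posz n)) ->
  L1 (fun e => f e * g (eta_at (Posz n) e)) /\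
  E (fun e => f e * g (eta_at (Posz n) e)) = E f * E (g \o eta_at (Posz n)).
Proof.
move=> pf mg intf intg; apply: expectation_splice => // e e' ee'; apply: pf => i ni.
by apply: ee'; apply/eqP => -[] ?; lia.
Qed.

Variables (t a : R) (h : R -> R).
Hypotheses (mh : measurable_fun [set: R] h)
  (ih : forall n, L1 (h \o @eta_at R n)) (Eh : forall n, E (h \o @eta_at R n) = 0)
  (i1 : forall n, L1 (@eta_at R n)) (E1 : forall n, E (@eta_at R n) = 0)
  (ixh : forall n, L1 ((fun x => x * h x) \o @eta_at R n))
  (Exh : forall n, E ((fun x => x * h x) \o @eta_at R n) = a).

Let S := partial_sum.
Let A n e := (riesz t h n e).1.
Let B n e := (riesz t h n e).2.

Lemma past_riesz n : past n (riesz t h n).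
Proof.
elim: n => [|n IH] // e e' ee' /=.
by rewrite (IH e e') => [|i ni]; rewrite /eta_at ee'// ltnW.
Qed.

Lemma past_partial_sum n : past n (partial_sum n).
Proof. by move=> e e' ee'; apply: eq_bigr => i _; exact: ee'. Qed.

(** Write [Y n = A n + 'i B n]. In [(S n + x) * Y n * (1 + 'i t h x)], with [x] the next variable,
    the terms with a lone [x] or [h x] have mean 0, and [x * h x] has mean [a]. Each step thus adds
    ['i t a * E (Y n) = 'i t a] to the mean of [S n * Y n]. *)
Lemma riesz_expectation n :
  [/\ L1 (A n) /\ E (A n) = 1, L1 (B n) /\ E (B n) = 0,
      L1 (fun e => S n e * A n e) /\ E (fun e => S n e * A n e) = 0 &
      L1 (fun e => S n e * B n e) /\
      E (fun e => S n e * B n e) = n%:R * (t * a)].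
Proof.
elim: n => [|n [[iA EA] [iB EB0] [iSA ESA] [iSB ESB]]].
  have i0 c : L1 (fun=> c) by exact: finite_measure_integrable_cst.
  have E0 c : E (fun=> c) = c.
    by rewrite /E Rintegral_cst//= probability_setT mulr1.
  have S0 e : S 0 e = 0 by rewrite /S /partial_sum big_ord0.
  have S00 (X : nat -> disorder R -> R) : (fun e => S 0 e * X 0%N e) = (fun=> 0).
    by apply/funext => e; rewrite S0 mul0r.
  by rewrite !S00 mul0r; split; split; [exact: i0|exact: E0|exact: i0|exact: E0|
    exact: i0|exact: E0|exact: i0|exact: E0].
have pA : past n (A n) by move=> e e' ee'; rewrite /A (past_riesz ee').
have pB : past n (B n) by move=> e e' ee'; rewrite /B (past_riesz ee').
have pSA : past n (fun e => S n e * A n e).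
  by move=> e e' ee'; rewrite (pA e e')// /S (past_partial_sum ee').
have pSB : past n (fun e => S n e * B n e).
  by move=> e e' ee'; rewrite (pB e e')// /S (past_partial_sum ee').
have mx : measurable_fun [set: R] (fun x : R => x) by exact: measurable_id.
have mxh : measurable_fun [set: R] (fun x => x * h x) by exact: measurable_funM.
pose z := @eta_at R (Posz n).
have [iAh EAh] := E_past pA mh iA (ih _).
have [iBh EBh] := E_past pB mh iB (ih _).
have [iAx EAx] := E_past pA mx iA (i1 _).
have [iBx EBx] := E_past pB mx iB (i1 _).
have [iAxh EAxh] := E_past pA mxh iA (ixh _).
have [iBxh EBxh] := E_past pB mxh iB (ixh _).
have [iSAh ESAh] := E_past pSA mh iSA (ih _).
have [iSBh ESBh] := E_past pSB mh iSB (ih _).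
rewrite ?Eh ?E1 ?Exh in EAh EBh EAx EBx EAxh EBxh ESAh ESBh.
have S1 e : S n.+1 e = S n e + z e by rewrite /S /partial_sum big_ord_recr.
have FA : A n.+1 = (fun e => A n e - t * (B n e * h (z e))).
  by apply/funext => e; rewrite /A /B /= /z; ring.
have FB : B n.+1 = (fun e => B n e + t * (A n e * h (z e))).
  by apply/funext => e; rewrite /A /B /= /z; ring.
have FSA : (fun e => S n.+1 e * A n.+1 e) = (fun e =>
    S n e * A n e + A n e * z e
    - t * (S n e * B n e * h (z e) + B n e * (z e * h (z e)))).
  by apply/funext => e; rewrite S1 FA; ring.
have FSB : (fun e => S n.+1 e * B n.+1 e) = (fun e =>
    S n e * B n e + B n e * z e
    + t * (S n e * A n e * h (z e) + A n e * (z e * h (z e)))).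
  by apply/funext => e; rewrite S1 FB; ring.
split.
- by rewrite FA; split; [apply: intB => //; exact: intZ|
    rewrite EB ?EZ// ?EA ?EBh; [ring|exact: intZ]].
- by rewrite FB; split; [apply: intD => //; exact: intZ|
    rewrite ED ?EZ// ?EB0 ?EAh; [ring|exact: intZ]].
- rewrite FSA; split; first by apply: intB; [exact: intD|apply: intZ; exact: intD].
  rewrite EB ?ED ?EZ ?ED//; try by [exact: intD|apply: intZ; exact: intD].
  by rewrite ESA EAx ESBh EBxh EB0 EA; ring.
- rewrite FSB; split; first by apply: intD; [exact: intD|apply: intZ; exact: intD].
  rewrite ED ?[E (fun e => _ + B n e * _)]ED ?EZ ?ED//;
    try by [exact: intD|apply: intZ; exact: intD].
  by rewrite ESB EBx ESAh EAxh EB0 EA -natr1; ring.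
Qed.

(** Each factor satisfies [|1 + 'i u|^2 = 1 + u^2]: the increment enters only at second order in
    [t], which is why the product stays bounded for [t] of order [1 / sqrt n]. *)
Lemma riesz_norm c n e : (forall x, h x ^+ 2 <= c) ->
  A n e ^+ 2 + B n e ^+ 2 <= (1 + t ^+ 2 * c) ^+ n.
Proof.
move=> hc; elim: n => [|n IH]; first by rewrite /A /B /= expr0; lra.
set u := t * h (eta_at (Posz n) e).
have -> : A n.+1 e ^+ 2 + B n.+1 e ^+ 2 = (A n e ^+ 2 + B n e ^+ 2) * (1 + u ^+ 2).
  by rewrite /A /B /= -/u; ring.
rewrite [leRHS]exprSr; apply: ler_pM => //; try by rewrite addr_ge0// sqr_ge0.
by rewrite lerD2l /u exprMn ler_wpM2l// sqr_ge0.
Qed.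

End partial_sums.

Section stationarity.
Context {R : realType} (P : probability (disorder R) R).
Hypothesis hP : iid_disorder P.

Lemma ge0_integral_theta a (f : disorder R -> \bar R) :
  measurable_fun [set: disorder R] f -> (forall e, 0 <= f e)%E ->
  (\int[P]_e f (theta a e) = \int[P]_e f e)%E.
Proof.
move=> mf f0.
have := @ge0_integral_pushforward _ _ _ _ R (theta a) (measurable_theta a) P setT f
  measurableT mf => /(_ _)/esym; rewrite preimage_setT => -> //.
apply: eq_measure_integral; first exact: measurable_theta.
by move=> mt A mA _; rewrite /= /pushforward theta_stationary.
Qed.

Lemma integrable_theta a (f : disorder R -> R) :
  P.-integrable setT (EFin \o f) -> P.-integrable setT (EFin \o (f \o theta a)).
Proof.
move=> /integrableP[mf intf]; apply/integrableP; split.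
  exact: (measurableT_comp mf (measurable_theta a)).
rewrite (@ge0_integral_theta a (fun e => `|(f e)%:E|%E))//.
exact: measurableT_comp.
Qed.

Lemma Rintegral_theta a (f : disorder R -> R) :
  P.-integrable setT (EFin \o f) -> \int[P]_e f (theta a e) = \int[P]_e f e.
Proof.
move=> intf; have mf := measurable_int _ intf.
have := @integral_pushforward _ _ _ _ R (theta a) (measurable_theta a) P setT
  (EFin \o f) mf => /(_ _ _)/esym; rewrite preimage_setT => intE.
rewrite /Rintegral (intE (integrable_theta a intf))//; congr fine.
apply: eq_measure_integral; first exact: measurable_theta.
by move=> mt A mA _; rewrite /= /pushforward theta_stationary.
Qed.

End stationarity.

Section partial_sum_lower_bound.
Context {R : realType} (P : probability (disorder R) R).
Hypothesis hP : iid_disorder P.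

Lemma measurable_eta_at_sqr x :
  measurable_fun [set: disorder R] (fun e => (eta_at x e ^+ 2)%:E).
Proof.
by apply/measurable_EFinP/measurable_funX; exact: measurable_eta_at.
Qed.

Lemma integrable_eta_at x : P.-integrable setT (EFin \o @eta_at R x).
Proof.
have [_ _ _ /(_ x)] := hP; rewrite unlock => E2.
apply: (@le_integrable _ _ _ P _ _ _ (EFin \o (fun e => 1 + eta_at x e ^+ 2))) => //.
- by apply/measurable_EFinP; exact: measurable_eta_at.
- move=> e _; rewrite lee_fin [leRHS]ger0_norm ?addr_ge0 ?sqr_ge0//.
  rewrite -real_normK ?num_real//.
  suff H (y : R) : 0 <= y -> y <= 1 + y ^+ 2 by exact: H.
  by move=> y0; have := sqr_ge0 (y - 1); nra.
- have ->: EFin \o (fun e => 1 + eta_at x e ^+ 2) =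
    (cst 1 \+ (fun e => (eta_at x e ^+ 2)%:E))%E by [].
  apply: integrableD => //; first exact: finite_measure_integrable_cst.
  apply/integrableP; split; first exact: measurable_eta_at_sqr.
  under eq_integral => e _ do rewrite gee0_abs ?lee_fin ?sqr_ge0//.
  by rewrite E2 ltry.
Qed.

(** A vanishing mean of [|eta_0|] would make [eta_0] zero almost surely, against its unit second
    moment. *)
Lemma Rintegral_norm_eta_at_gt0 : 0 < \int[P]_e `|eta_at 0 e|.
Proof.
rewrite lt_def Rintegral_ge0 ?andbT//.
apply/eqP => E0.
have i0 := integrable_eta_at 0; have m0 := measurable_int _ i0.
have E0' : (\int[P]_e `|(EFin \o eta_at 0) e| = 0)%E.
  move: E0; rewrite /Rintegral => /eqP; rewrite fine_eq0; first by move/eqP.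
  by have /integrableP[_ ?] := i0; rewrite ge0_fin_numE// integral_ge0.
move/(ae_eq_integral_abs _ measurableT m0) : E0' => ae0.
have [_ _ _ /(_ 0)] := hP; rewrite unlock.
rewrite (ae_eq_integral (cst 0%E))//.
- by rewrite integral0 => /eqP; rewrite eqe eq_sym oner_eq0.
- exact: measurable_eta_at_sqr.
- by apply: filterS ae0 => e /(_ I)/= [-> _]; rewrite expr0n.
Qed.

(* Testing the partial sum against the imaginary part of a Riesz product, which
   stays bounded for [t = 1 / sqrt n], replaces the central limit theorem. *)
Lemma partial_sum_lower_bound : exists2 c : R, 0 < c &
  forall n, (0 < n)%N ->
    ((c * Num.sqrt n%:R)%:E <= \int[P]_e `|partial_sum n e|%:E)%E.
Proof.
(* A sign function with value 1 at 0, so that [|h0| = 1] everywhere while [x * h0 x = |x|]. *)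
pose h0 (x : R) : R := if 0 <= x then 1 else -1.
have mh0 : measurable_fun [set: R] h0.
  by apply: measurable_fun_ifT => //; exact: measurable_fun_ler.
have h01 x : `|h0 x| = 1 by rewrite /h0; case: ifP; rewrite ?normrN normr1.
have xh0 x : x * h0 x = `|x|.
  by rewrite /h0; case: lerP => x0; [rewrite mulr1 ger0_norm|rewrite mulrN1 ltr0_norm].
have me := @measurable_eta_at R.
have ih0 x : P.-integrable setT (EFin \o (h0 \o eta_at x)).
  apply: (@le_integrable _ _ _ P _ _ _ (cst 1%E)) => //.
  - by apply/measurable_EFinP; exact: measurableT_comp.
  - by move=> e _; rewrite /= h01 normr1.
  - exact: finite_measure_integrable_cst.
pose m := \int[P]_e h0 (eta_at 0 e).
have eta_theta x e : eta_at x e = eta_at 0 (theta x e :> disorder R).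
  by rewrite /eta_at /theta add0r.
have Eh0 x : \int[P]_e h0 (eta_at x e) = m.
  under eq_Rintegral => e _ do rewrite eta_theta.
  exact: (Rintegral_theta hP x (ih0 0)).
have E1 x : \int[P]_e eta_at x e = 0.
  by have [_ _ /(_ x) + _] := hP; rewrite unlock /Rintegral => ->.
have ixh0 x : P.-integrable setT (EFin \o (fun e => `|eta_at x e|)).
  exact/integrable_norm/integrable_eta_at.
pose a := \int[P]_e `|eta_at 0 e|.
have Exh0 x : \int[P]_e `|eta_at x e| = a.
  under eq_Rintegral => e _ do rewrite eta_theta.
  exact: (Rintegral_theta hP x (ixh0 0)).
have icst c : P.-integrable setT (EFin \o (fun=> c : R)).
  exact: finite_measure_integrable_cst.
have m1 : `|m| <= 1.
  apply: (le_trans (le_normr_Rintegral measurableT (ih0 0))).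
  under eq_Rintegral => e _ do rewrite h01.
  by rewrite Rintegral_cst//= probability_setT mul1r.
(* Centring gives [h] mean 0. It leaves the mean of [x * h x] equal to that of [|x|], since [x] is
   centred, and costs only the bound [|h| <= 2]. *)
pose h x := h0 x - m.
have mh : measurable_fun [set: R] h by apply: measurable_funB.
have h4 x : h x ^+ 2 <= 4.
  have := h01 x; have := m1; rewrite ler_norml => /andP[? ?].
  by move=> /eqP; rewrite eqr_norml => /andP[/orP[]/eqP + _]; rewrite /h => ->; nra.
have ih x : P.-integrable setT (EFin \o (h \o eta_at x)).
  by have := integrableB measurableT (ih0 x) (icst m).
have Eh x : \int[P]_e h (eta_at x e) = 0.
  transitivity (\int[P]_e h0 (eta_at x e) - \int[P]_e m).
    exact: (RintegralB measurableT (ih0 x) (icst m)).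
  rewrite Eh0 Rintegral_cst//= probability_setT mulr1.
  by rewrite subrr.
have xhE x : x * h x = `|x| - m * x by rewrite /h mulrBr xh0 mulrC.
have imx x : P.-integrable setT (EFin \o (fun e => m * eta_at x e)).
  by have := integrableZl measurableT m (integrable_eta_at x).
have ixh x : P.-integrable setT (EFin \o (fun e => eta_at x e * h (eta_at x e))).
  under [X in _.-integrable _ X]eq_fun => e do rewrite /= xhE.
  by have := integrableB measurableT (ixh0 x) (imx x).
have Exh x : \int[P]_e (eta_at x e * h (eta_at x e)) = a.
  under eq_Rintegral => e _ do rewrite xhE.
  transitivity (\int[P]_e `|eta_at x e| - \int[P]_e (m * eta_at x e)).
    exact: (RintegralB measurableT (ixh0 x) (imx x)).
  rewrite Exh0 (@RintegralZl _ _ _ P)//; last exact: integrable_eta_at.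
  by rewrite E1 mulr0 subr0.
(* With [t^2 = 1 / n] and [h^2 <= 4] the squared modulus of the Riesz product is at most
   [(1 + 4 / n)^n <= exp 4], so its imaginary part is at most [exp 2]; the mean of [S * B] is
   [n * t * a = sqrt n * a]. *)
exists (a / expR 2); first by rewrite divr_gt0 ?expR_gt0// Rintegral_norm_eta_at_gt0.
move=> n n0; pose t := (Num.sqrt n%:R)^-1 : R.
have s0 : 0 < Num.sqrt n%:R :> R by rewrite sqrtr_gt0 ltr0n.
have [_ _ _ [iSB ESB]] := riesz_expectation hP t mh ih Eh
  (fun x => integrable_eta_at x) E1 ixh Exh n.
have B4 e : `|(riesz t h n e).2| <= expR 2.
  rewrite -ler_sqr ?nnegrE ?expR_ge0// real_normK ?num_real//.
  have := riesz_norm t n e h4 => /(le_trans _) H.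
  apply: (le_trans (H _ _)); first by rewrite lerDr sqr_ge0.
  have -> : expR 2 ^+ 2 = expR (n%:R^-1 * 4) ^+ n :> R.
    by rewrite -!expRM_natl; congr expR; field; rewrite pnatr_eq0 -lt0n.
  rewrite /t exprVn sqr_sqrtr ?ler0n//.
  apply: lerXn2r; rewrite ?nnegrE ?expR_ge0//; exact: expR_ge1Dx.
have iS : P.-integrable setT (EFin \o partial_sum n).
  rewrite (_ : EFin \o _ =
      (fun e => \sum_(i <- enum 'I_n) (eta_at (Posz i) e)%:E)%E); last first.
    by apply/funext => e; rewrite /= /partial_sum sumEFin big_enum.
  by apply: integrable_sum => //= i _; exact: integrable_eta_at.
have : n%:R * (t * a) <= expR 2 * \int[P]_e `|partial_sum n e|.
  rewrite -ESB -RintegralZl//; last exact: integrable_norm.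
  apply: le_Rintegral => //.
    by have := integrableZl measurableT (expR 2) (integrable_norm iS).
  move=> e _; apply: (le_trans (ler_norm _)); rewrite normrM mulrC.
  by rewrite ler_wpM2r.
have -> : n%:R * (t * a) = Num.sqrt n%:R * a.
  by rewrite mulrA -[in X in X * t](@sqr_sqrtr _ n%:R) ?ler0n// expr2 /t mulfK ?gt_eqF.
move=> H; rewrite -[leRHS]fineK; last first.
  have /integrableP[_ ?] := iS; rewrite ge0_fin_numE//; exact: integral_ge0.
rewrite lee_fin -/(Rintegral _ _ _) mulrAC ler_pdivrMr ?expR_gt0//.
by rewrite mulrC (le_trans H)// mulrC.
Qed.

End partial_sum_lower_bound.

(** * Couplings across the boundary of a box *)

Section power_series.
Context {R : realType}.

(** Cauchy condensation: the block of [2^m] integers from [2^m] on contributes at most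
    [(2^m)^(1 - s) = r^m], and [r < 1]. *)
Lemma powR_series_le (s : R) : 1 < s -> exists C : R, forall N,
  \sum_(0 <= n < N) n.+1%:R `^ (- s) <= C.
Proof.
move=> s1; pose r : R := 2 `^ (1 - s).
have r0 : 0 <= r by exact: powR_ge0.
have r1 : r < 1.
  rewrite /r -opprB powRN invf_lt1 ?powR_gt0//.
  have := @gt0_ltr_powR _ (s - 1) _ 1 2; rewrite powR1; apply; rewrite ?nnegrE ?ltr1n//.
  by rewrite subr_gt0.
pose u n : R := n.+1%:R `^ (- s).
have u0 n : 0 <= u n by exact: powR_ge0.
(* Term [n] carries the integer [n + 1], hence the block boundaries [2^m - 1]. *)
have dyadic m : \sum_(0 <= n < (2 ^ m).-1) u n <= \sum_(0 <= j < m) r ^+ j.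
  elim: m => [|m IH]; first by rewrite !big_geq.
  have p2 : (0 < 2 ^ m)%N by rewrite expn_gt0.
  have e2 : (2 ^ m.+1 = 2 ^ m + 2 ^ m)%N by rewrite expnS mul2n addnn.
  rewrite big_nat_recr//= (@big_cat_nat _ _ _ (2 ^ m).-1)//=; last by lia.
  apply: lerD => //.
  apply: (@le_trans _ _ (\sum_((2 ^ m).-1 <= n < (2 ^ m.+1).-1) (2 ^ m)%:R `^ (- s))).
    apply: ler_sum_nat => n /andP[n1 _]; rewrite /u !powRN.
    rewrite lef_pV2 ?posrE ?powR_gt0 ?ltr0n//.
    by rewrite ge0_ler_powR ?nnegrE ?ler0n ?ler_nat//; [lra|lia].
  rewrite sumr_const_nat.
  have -> : ((2 ^ m.+1).-1 - (2 ^ m).-1 = 2 ^ m)%N by lia.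
  rewrite /r -powR_mulrn ?powR_ge0// -powRrM mulrC.
  by rewrite -[leLHS]mulr_natr natrX -powR_mulrn// -powRrM -powRD ?pnatr_eq0 ?implybT//;
    rewrite mulrBr mulr1 mulrN addrC.
exists (1 - r)^-1 => N.
apply: (@le_trans _ _ (\sum_(0 <= n < (2 ^ N).-1) u n)).
  rewrite [leRHS](@big_cat_nat _ _ _ N)//=; last first.
    by have := @ltn_expl 2 N isT; lia.
  by rewrite lerDl sumr_ge0.
apply: (le_trans (dyadic N)).
have d0 : 0 < 1 - r by lra.
rewrite -[leRHS]mul1r ler_pdivlMr// mulrC big_mkord.
have := subrX1 r N; have := exprn_ge0 N r0; nra.
Qed.

End power_series.

Section coupling_sums.
Context {R : realType}.

Lemma esum_powR_lty (s : R) : 1 < s ->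
  (\esum_(k in [set k : int | k != 0%R]) ((`|k|%N)%:R `^ (- s))%:E < +oo)%E.
Proof.
move=> s1; have [C hC] := powR_series_le s1.
pose u n : \bar R := (n.+1%:R `^ (- s))%:E.
have u0 n : (0 <= u n)%E by rewrite lee_fin powR_ge0.
have uC : (\esum_(n in [set: nat]) u n <= C%:E)%E.
  rewrite -nneseries_esumT//; apply: lime_le; first exact: is_cvg_nneseries.
  by apply: nearW => n; rewrite sumEFin lee_fin.
have imE (f : nat -> int) (D : set int) : injective f ->
    (forall n, absz (f n) = n.+1) -> D `<=` f @` setT ->
    (\esum_(k in D) ((`|k|%N)%:R `^ (- s))%:E <= C%:E)%E.
  move=> fI fabs Df; apply: le_trans uC.
  rewrite [leRHS](_ : _ = \esum_(k in f @` setT) ((`|k|%N)%:R `^ (- s))%:E).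
    rewrite esum_mkcond [leRHS]esum_mkcond; apply: le_esum => k _.
    case: ifPn => [/set_mem/Df kf|_]; first by rewrite mem_set.
    by case: ifP => // _; rewrite lee_fin powR_ge0.
  rewrite esum_image; last by move=> x y _ _ /fI.
  by apply: eq_esum => n _; rewrite /u fabs.
rewrite (esumID [set k : int | 0 < k])//.
apply: (@le_lt_trans _ _ (C%:E + C%:E)%E); last by rewrite -EFinD ltry.
apply: leeD.
  apply: (imE (fun n => Posz n.+1)) => //; first by move=> x y [].
  by move=> [[|n]|n] [_ /=]// _; exists n.
apply: (imE Negz) => //; first by move=> x y [].
by move=> [[|n]|n] [/= + /negP]// _; exists n.
Qed.

(** The weight [|k|^theta] will pay for the number of boundary pairs at displacement [k].
    Summability requires [alpha - theta > 1], and the final comparison [theta > 1/2]; both are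
    possible because [alpha > 3/2]. *)
Lemma coupling_weighted_lty (alpha : \bar R) : ((3 / 2)%:E < alpha)%E ->
  exists2 theta : R, 1 / 2 < theta <= 1 &
  (\esum_(k in [set k : int | k != 0%R])
     (coupling alpha k * (`|k|%N)%:R `^ theta)%:E < +oo)%E.
Proof.
case: alpha => [r||]; rewrite ?lte_fin => h; last by [].
  (* The midpoint of [1/2] and [r - 1] is [(r - 1/2) / 2]; the cap at 1 keeps the exponent
     [1 - theta] nonnegative. *)
  exists (Num.min 1 ((r - 1 / 2) / 2)); first by rewrite lt_min ge_min lexx; lra.
  set theta := Num.min _ _.
  have ht : theta <= (r - 1 / 2) / 2 by rewrite /theta ge_min lexx orbT.
  apply: le_lt_trans (@esum_powR_lty (r - theta) _); last by lra.
  apply: le_esum => k /= k0; rewrite lee_fin -powRD ?opprB ?[- r + _]addrC//.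
  by rewrite pnatr_eq0 absz_eq0 k0 implybT.
exists 1; first by lra.
apply: (@esum_finsupp_lty _ _ [fset (1 : int); (-1 : int)]%fset) => y.
  by rewrite mulr_ge0 ?coupling_ge0 ?powR_ge0.
rewrite !inE /coupling => hy; case: eqP => [|_]; last by rewrite mul0r.
by move: hy; lia.
Qed.

Lemma coupling_lty (alpha : \bar R) (theta : R) : 0 <= theta ->
  (\esum_(k in [set k : int | k != 0%R])
     (coupling alpha k * (`|k|%N)%:R `^ theta)%:E < +oo)%E ->
  (\esum_(k in [set k : int | k != 0%R]) (coupling alpha k)%:E < +oo)%E.
Proof.
move=> t0; apply: le_lt_trans; apply: le_esum => k /= k0; rewrite lee_fin.
rewrite ler_peMr ?coupling_ge0// -[leLHS](powRr0 (`|k|%N)%:R) ler_powR//.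
by rewrite ler1n absz_gt0.
Qed.

Definition box (L : nat) : {fset int} := [fset Posz i | i in iota 0 L]%fset.

Lemma in_box L x : (x \in box L) = (0 <= x < Posz L).
Proof.
apply/imfsetP/idP => [[i /=]|]; first by rewrite mem_iota => iL ->; lia.
by case: x => [n|n] // nL; exists n => //=; rewrite mem_iota; lia.
Qed.

Definition boundary (L : {fset int}) : set (int * int) :=
  [set p | p.1 \in L /\ p.2 \notin L].

(** A site pushed out of the box by a displacement [k] lies among the first [|k|] sites if [k > 0]
    and among the last [|k|] if [k < 0]. *)
Lemma box_shift_card L (k : int) :
  (#|` [fset x in box L | (x - k)%R \notin box L]%fset| <= minn `|k| L)%N.
Proof.
rewrite leq_min; apply/andP; split; last first.
  apply: (@leq_trans #|` box L|); first exact/fsubset_leq_card/fset_sub.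
  rewrite -[leqRHS](size_iota 0) -(size_map Posz); apply: uniq_leq_size => //.
  by move=> x; rewrite in_box => xL; apply/mapP; exists `|x|%N; rewrite ?mem_iota; lia.
pose f (i : nat) : int := if 0 < k then Posz i else Posz L - 1 - Posz i.
rewrite -[leqRHS](size_iota 0) -(size_map f) cardfE -cardfE.
apply: uniq_leq_size => // x; rewrite !inE !in_box => /andP[xL xk].
apply/mapP; exists (if 0 < k then absz x else absz (Posz L - 1 - x)%R).
  by rewrite mem_iota; case: ifPn; lia.
by rewrite /f; move: (x : int) xL {xk} => y yL; case: (0 < k); lia.
Qed.

(** The minimum is the product of its powers [theta] and [1 - theta]; one factor is bounded through
    [m], the other through [n]. *)
Lemma minn_powR (theta : R) (m n : nat) : 0 <= theta <= 1 -> (0 < m)%N -> (0 < n)%N ->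
  (minn m n)%:R <= m%:R `^ theta * n%:R `^ (1 - theta).
Proof.
move=> /andP[t0 t1] m0 n0.
have k0 : (0 < minn m n)%N by rewrite leq_min m0.
rewrite -[leLHS](@powRr1 _ (minn m n)%:R)// -[X in _ `^ X](subrKC theta).
rewrite powRD; last by rewrite pnatr_eq0 -lt0n k0 implybT.
by apply: ler_pM; rewrite ?powR_ge0//;
  rewrite ge0_ler_powR ?nnegrE ?ler0n ?ler_nat ?geq_minl ?geq_minr ?subr_ge0.
Qed.

(** Boundary pairs [(x, y)] are grouped by [k = x - y]. Each group has at most
    [min(|k|, L) <= |k|^theta * L^(1 - theta)] members, all with the same coupling. *)
Lemma boundary_coupling_le (alpha : \bar R) (theta : R) (L : nat) :
  0 <= theta <= 1 -> (0 < L)%N ->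
  (\esum_(p in boundary (box L)) (coupling alpha (p.1 - p.2))%:E <=
   (\esum_(k in [set k : int | k != 0%R])
     (coupling alpha k * (`|k|%N)%:R `^ theta)%:E) * (L%:R `^ (1 - theta))%:E)%E.
Proof.
move=> t01 L0.
pose F k := [fset x in box L | (x - k)%R \notin box L]%fset.
pose B (k : int) : set int := [set` F k].
rewrite (@reindex_esum _ _ _ ([set k : int | k != 0%R] `*`` B) _
  (fun p => (p.2, p.2 - p.1))); last first.
  split => [[k x] [/= k0]|[k x] [k' x'] _ _ [-> /addrI/oppr_inj ->//]|[x y] [/= xL yL]].
    by rewrite /B /= !inE => /andP[].
  exists (x - y, x) => /=; last by rewrite opprB addrC subrK.
  split; last by rewrite /B /= !inE xL opprB addrC subrK.
  by rewrite /= subr_eq0; apply: contraNneq yL => <-.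
rewrite -(@esum_esum _ _ _ _ _ (fun k x => (coupling alpha (x - (x - k)))%:E))//; last first.
  by move=> k x; rewrite lee_fin coupling_ge0.
rewrite -esumZr; [|exact: powR_ge0|
  by move=> k; rewrite lee_fin mulr_ge0 ?coupling_ge0 ?powR_ge0].
apply: le_esum => k /= k0.
under eq_esum do rewrite opprB addrC subrK.
have fB : finite_set (B k) by exact: finite_fset.
rewrite esum_fset//; last by move=> x _; rewrite lee_fin coupling_ge0.
rewrite fsbig_finite//= (@sumEFin _ _ _ xpredT (fun=> coupling alpha k)) lee_fin.
rewrite big_const_seq count_predT set_fsetK iter_addr_0.
rewrite -[X in X <= _]mulr_natr -mulrA ler_wpM2l ?coupling_ge0//.
apply: le_trans (minn_powR t01 _ L0); last by rewrite absz_gt0.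
by rewrite ler_nat; exact: box_shift_card.
Qed.

End coupling_sums.

(** * Raising a configuration on a finite set *)

Section sum_exchange.
Context {R : realType}.

Lemma esum_exchange (T1 T2 : choiceType) (D1 : set T1) (D2 : set T2)
    (a : T1 -> T2 -> \bar R) : (forall i j, 0 <= a i j)%E ->
  (\esum_(i in D1) \esum_(j in D2) a i j =
   \esum_(j in D2) \esum_(i in D1) a i j)%E.
Proof.
move=> a0; rewrite !esum_esum//.
rewrite (@reindex_esum _ _ _ (D2 `*` D1) _ (fun p => (p.2, p.1)))//.
split => [[i j] []//|[i j] [i' j'] _ _ [-> ->]//|[i j] [? ?]].
by exists (j, i).
Qed.

Lemma measurable_rsum d (X : measurableType d) (T : countType) (D : set T)
    (f : T -> X -> R) : (forall t, measurable_fun [set: X] (f t)) ->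
  measurable_fun [set: X] (fun x => rsum D (f^~ x)).
Proof.
move=> mf; apply: (@measurableT_comp _ _ _ _ _ _ fine) => //.
apply: emeasurable_funB; apply: measurable_esum => // t.
  under eq_fun do rewrite funeposE /=; apply: measurable_maxe => //.
  exact/measurable_EFinP.
under eq_fun do rewrite funenegE /=; apply: measurable_maxe => //.
by apply/measurable_EFinP; exact: measurable_funN.
Qed.

End sum_exchange.

Section configurations.
Context {R : realType} {alpha : \bar R}.

Lemma measurable_coord d (Y : measurableType d) (f : int -> Y) x :
  measurable_fun [set: Omega alpha] (fun phi => f (phi_at x phi)).
Proof.
move=> _ B mB; apply: sub_sigma_algebra; exists x => //.
by exists (f @^-1` B).
Qed.

(** No measurability of [f] is asked, since the generators use every set of integers. Splitting over
    the countably many values of the first coordinate reduces to one coordinate. *)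
Lemma measurable_coord2 d (Y : measurableType d) (f : int -> int -> Y) x y :
  measurable_fun [set: Omega alpha] (fun phi => f (phi_at x phi) (phi_at y phi)).
Proof.
move=> _ B mB; rewrite setTI.
rewrite [X in measurable X](_ : _ = \bigcup_(a in [set: int])
  ((fun phi : Omega alpha => phi_at x phi == a) @^-1` [set true] `&`
   (fun phi => f a (phi_at y phi)) @^-1` B)).
  apply: countable_bigcupT_measurable => [|a]; first exact: countableP.
  apply: measurableI.
    by rewrite -[X in measurable X]setTI; exact: (measurable_coord (fun b => b == a)).
  by rewrite -[X in measurable X]setTI; exact: measurable_coord.
apply/seteqP; split => [phi fB|phi [a _ [/= /eqP -> //]]].
exists (phi_at x phi) => //; split => /=; [exact: eqxx|exact: fB].
Qed.

Lemma measurable_to_Omega d (X : measurableType d) (f : X -> Omega alpha) :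
  (forall x (B : set int), measurable ((fun w => phi_at x (f w)) @^-1` B)) ->
  measurable_fun [set: X] f.
Proof.
move=> mf; apply: (@measurability _ _ X (Omega alpha) setT f (Omega_cyl alpha)) => //.
by move=> _ [_ [x _ [B _ <-]] <-]; rewrite !setTI; exact: mf.
Qed.

Lemma phi_at_glue (L : {fset int}) (xi : {ffun L -> int}) (zeta : Omega alpha) x :
  phi_at x (Defs.glue xi zeta) = glue_fun xi (fun y => phi_at y zeta) x.
Proof. by []. Qed.

Lemma phi_at_glue_in (L : {fset int}) (xi : {ffun L -> int}) (zeta : Omega alpha)
  (x : L) : phi_at (val x) (Defs.glue xi zeta) = xi x.
Proof. by rewrite phi_at_glue /glue_fun valK. Qed.

Lemma phi_at_glue_out (L : {fset int}) (xi : {ffun L -> int}) (zeta : Omega alpha) y :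
  y \notin L -> phi_at y (Defs.glue xi zeta) = phi_at y zeta.
Proof. by move=> yL; rewrite phi_at_glue /glue_fun insubN. Qed.

Lemma measurable_glue (L : {fset int}) (xi : {ffun L -> int}) :
  measurable_fun [set: Omega alpha] (Defs.glue xi).
Proof.
apply: measurable_to_Omega => x B; rewrite -[X in measurable X]setTI.
have [xL|xL] := boolP (x \in L).
  have -> : (fun w : Omega alpha => phi_at x (Defs.glue xi w)) = cst (xi [` xL]%fset).
    by apply/funext => w; rewrite -[x]/(val [` xL]%fset) phi_at_glue_in.
  rewrite setTI preimage_cst; case: ifP => _; [exact: measurableT|exact: measurable0].
have -> : (fun w : Omega alpha => phi_at x (Defs.glue xi w)) = (fun w => phi_at x w).
  by apply/funext => w; rewrite phi_at_glue_out.
by apply: sub_sigma_algebra; exists x => //; exists B.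
Qed.

Lemma measurable_tau a : measurable_fun [set: Omega alpha] (tau a).
Proof.
apply: measurable_to_Omega => x B; apply: sub_sigma_algebra.
by exists (x + a) => //; exists B => //; rewrite setTI.
Qed.

(** The condition defining [Omega alpha] is centred at 0; its invariance under shifts moves it to
    any site [x] of the box. *)
Lemma Omega_translate_lty (phi : Omega alpha) (x : int) :
  (\esum_(y in [set y | y != x]) (coupling alpha (x - y) * `|phi_at y phi|%:~R)%:E < +oo)%E.
Proof.
have := Omega_set_shift x (svalP phi); rewrite /Omega_set /=.
have -> // : \esum_(y in [set y | y != x]) (coupling alpha (x - y) * `|phi_at y phi|%:~R)%:E =
  \esum_(y in [set y : int | y != 0%R]) (coupling alpha y * (`|sval phi (y + x)%R|%N)%:R)%:E.
rewrite (@reindex_esum _ _ _ [set y : int | y != 0%R] _ (fun y => y + x)).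
  apply: eq_esum => y _; rewrite /phi_at opprD addrCA subrr addr0.
  congr (_ * _)%:E.
  by rewrite /coupling abszN.
split => [y /= y0|y z _ _ /addIr//|y /= yx].
  by rewrite -subr_eq0 addrK.
by exists (y - x); rewrite /= ?subr_eq0 ?subrK.
Qed.

End configurations.

Section energy.
Context {R : realType} {alpha : \bar R}.
Variables (lambda beta : R) (eta : disorder R) (L : {fset int}).
Implicit Types (xi : {ffun L -> int}) (zeta phi : Omega alpha).
Local Notation J := (coupling alpha).

Hypothesis J_lty : (\esum_(k in [set k : int | k != 0%R]) (J k)%:E < +oo)%E.

(** This is [G] of the overview, and [boundary_mass] below is [c]. Extended real values allow sums
    and integrals to be exchanged without finiteness conditions. *)
Definition boundary_energy phi : \bar R :=
  \esum_(p in boundary L)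
    (J (p.1 - p.2) * `|phi_at p.1 phi - phi_at p.2 phi|%:~R)%:E.

Definition boundary_mass : \bar R :=
  \esum_(p in boundary L) (J (p.1 - p.2))%:E.

Lemma esum_boundary (a : int -> int -> R) : (forall x y, 0 <= a x y) ->
  (\esum_(p in boundary L) (a p.1 p.2)%:E =
   \sum_(x : L) \esum_(y in ~` [set` L]) (a (val x) y)%:E)%E.
Proof.
move=> a0.
have -> : boundary L = [set` L] `*`` (fun=> ~` [set` L]).
  by apply/seteqP; split => -[x y] [/= xL /negP yL].
rewrite -(@esum_esum _ _ _ _ _ (fun x y => (a x y)%:E))//; last first.
  by move=> x y; rewrite lee_fin.
rewrite esum_fset//; last by move=> x _; apply: esum_ge0 => y _; rewrite lee_fin.
by rewrite fsbig_finite//= set_fsetK big_seq_fsetE.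
Qed.

Section out_summability.
Variable x : L.
Let out : set int := ~` [set` L].

Let out_neq : out `<=` [set y | y != val x].
Proof. by move=> y yL; apply/eqP => yx; apply: yL; rewrite /= yx; exact: valP. Qed.

Lemma rsummable_coupling : rsummable out (fun y => J (val x - y)).
Proof.
apply: (@le_lt_trans _ _ (\esum_(y in [set y | y != val x]) (J (val x - y))%:E)%E).
  rewrite esum_mkcond [leRHS]esum_mkcond; apply: le_esum => y _.
  case: ifPn => [/set_mem/out_neq yx|_].
    by rewrite mem_set// lee_fin ger0_norm ?coupling_ge0.
  by case: ifP => // _; rewrite lee_fin coupling_ge0.
rewrite (@reindex_esum _ _ _ [set k : int | k != 0%R] _ (fun k => val x - k)).
  by under eq_esum do rewrite opprB addrC subrK.
split => [k /= k0|k l _ _ /addrI/oppr_inj//|y /= yx].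
  by apply: contra_neq k0 => /eqP; rewrite -subr_eq0 addrAC subrr add0r oppr_eq0 => /eqP.
exists (val x - y); last by rewrite opprB addrC subrK.
by rewrite /= subr_eq0 eq_sym.
Qed.

Lemma rsummable_coupling_conf zeta :
  rsummable out (fun y => J (val x - y) * (phi_at y zeta)%:~R).
Proof.
apply: le_lt_trans (Omega_translate_lty zeta (val x)).
rewrite esum_mkcond [leRHS]esum_mkcond; apply: le_esum => y _.
case: ifPn => [/set_mem/out_neq yx|_].
  by rewrite mem_set// lee_fin normrM ger0_norm ?coupling_ge0// intr_norm.
by case: ifP => // _; rewrite lee_fin mulr_ge0 ?coupling_ge0 ?ler0z.
Qed.

Lemma rsummableZ (D : set int) c (f : int -> R) :
  rsummable D f -> rsummable D (fun y => c * f y).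
Proof.
rewrite /rsummable; under [X in _ -> (X < _)%E]eq_esum do rewrite normrM EFinM.
rewrite esumZl// => h.
by apply: lte_mul_pinfty => //; rewrite ?lee_fin//; apply: esum_ge0 => t _; rewrite lee_fin.
Qed.

(** The squares of [zeta] cancel in [(c - zeta)^2 - zeta^2 = c^2 - 2 c zeta], so summability against
    the first power of [zeta] is enough. *)
Lemma rsummable_energy zeta (c : int) : rsummable out (fun y =>
  J (val x - y) * ((c - phi_at y zeta)%:~R ^+ 2 - (phi_at y zeta)%:~R ^+ 2)).
Proof.
have -> : (fun y => J (val x - y) *
      ((c - phi_at y zeta)%:~R ^+ 2 - (phi_at y zeta)%:~R ^+ 2)) =
    (fun y => c%:~R ^+ 2 * J (val x - y) +
      (- 2 * c%:~R) * (J (val x - y) * (phi_at y zeta)%:~R)).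
  by apply/funext => y; rewrite intrB; ring.
apply: rsummableD; first exact/rsummableZ/rsummable_coupling.
exact/rsummableZ/rsummable_coupling_conf.
Qed.

Lemma rsummable_boundary zeta (c : int) : rsummable out (fun y =>
  J (val x - y) * `|c - phi_at y zeta|%:~R).
Proof.
apply: (@rsummable_le _ _ _ _ (fun y => J (val x - y) * (c - phi_at y zeta)%:~R)).
  by move=> y _; rewrite intr_norm !normrM normr_id.
have -> : (fun y => J (val x - y) * (c - phi_at y zeta)%:~R) =
    (fun y => c%:~R * J (val x - y) + (- 1) * (J (val x - y) * (phi_at y zeta)%:~R)).
  by apply/funext => y; rewrite intrB; ring.
apply: rsummableD; first exact/rsummableZ/rsummable_coupling.
exact/rsummableZ/rsummable_coupling_conf.
Qed.

(** For [s = 1] or [-1], raising [c] by [s] changes [(c - zeta)^2] by [2 s (c - zeta) + 1], whose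
    absolute value is at most [1 + 2 |c - zeta|]. *)
Lemma rsum_energy_shift zeta (c s : int) : s ^+ 2 = 1 ->
  rsum out (fun y =>
    J (val x - y) * ((c + s - phi_at y zeta)%:~R ^+ 2 - (phi_at y zeta)%:~R ^+ 2)) <=
  rsum out (fun y =>
    J (val x - y) * ((c - phi_at y zeta)%:~R ^+ 2 - (phi_at y zeta)%:~R ^+ 2)) +
  (fine (\esum_(y in out) (J (val x - y))%:E) +
   2 * fine (\esum_(y in out) (J (val x - y) * `|c - phi_at y zeta|%:~R)%:E)).
Proof.
move=> s2.
have s2R : s%:~R ^+ 2 = 1 :> R by rewrite -rmorphXn/= s2.
have s1 : `|s%:~R| = 1 :> R by apply/eqP; rewrite -sqrp_eq1// real_normK ?num_real// s2R.
pose v y := J (val x - y) * (2 * s%:~R * (c - phi_at y zeta)%:~R + s%:~R ^+ 2).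
have vle y : `|v y| <= J (val x - y) + 2 * (J (val x - y) * `|c - phi_at y zeta|%:~R).
  rewrite /v s2R normrM (ger0_norm (coupling_ge0 _ _)) intr_norm.
  move: (coupling_ge0 alpha (val x - y)); move: (J _) => j j0.
  rewrite [leRHS](_ : _ = j * (1 + 2 * `|(c - phi_at y zeta)%:~R|)); last by ring.
  apply: ler_wpM2l => //.
  apply: le_trans (ler_normD _ _) _; rewrite !normrM s1 normr1 mulr1.
  by rewrite (ger0_norm (ler0n _ _)) addrC.
have w0 y : 0 <= J (val x - y) * `|c - phi_at y zeta|%:~R.
  by rewrite mulr_ge0 ?coupling_ge0 ?ler0z.
have sw := rsummable_boundary zeta c.
have sv : rsummable out v.
  apply: rsummable_le (rsummableD rsummable_coupling (rsummableZ 2 sw)) => y _.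
  by rewrite [leRHS]ger0_norm// addr_ge0 ?mulr_ge0 ?coupling_ge0 ?ler0z.
rewrite [X in X <= _](_ : _ = rsum out (fun y =>
    J (val x - y) * ((c - phi_at y zeta)%:~R ^+ 2 - (phi_at y zeta)%:~R ^+ 2)
    + v y)); last first.
  by congr rsum; apply/funext => y; rewrite /v !intrB !intrD; ring.
rewrite rsumD//; last exact: rsummable_energy.
rewrite lerD2l; apply: le_trans (rsum_le_norm sv) _.
have fJ := rsummable_fin_num (fun y _ => coupling_ge0 alpha (val x - y)) rsummable_coupling.
have fw := rsummable_fin_num (fun y _ => w0 y) sw.
have E : (\esum_(y in out) (J (val x - y) +
      2 * (J (val x - y) * `|c - phi_at y zeta|%:~R))%:E =
    \esum_(y in out) (J (val x - y))%:E +
    2%:E * \esum_(y in out) (J (val x - y) * `|c - phi_at y zeta|%:~R)%:E)%E.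
  rewrite -esumZl//; under eq_esum do rewrite EFinD EFinM.
  by rewrite esumD// => y _; rewrite lee_fin ?coupling_ge0// mulr_ge0.
rewrite [leRHS](_ : _ = fine (\esum_(y in out) (J (val x - y) +
      2 * (J (val x - y) * `|c - phi_at y zeta|%:~R))%:E)); last first.
  by rewrite E fineD// ?fineM// fin_numM.
apply: fine_le.
- by have := rsummable_fin_num (fun y _ => normr_ge0 (v y)); apply;
    rewrite /rsummable; under eq_esum do rewrite normr_id.
- by rewrite E fin_numD fJ fin_numM.
- by apply: le_esum => y _; rewrite lee_fin.
Qed.

End out_summability.

Definition raise (s : int) xi : {ffun L -> int} := [ffun x => xi x + s].

Lemma boundary_mass_fin_num : boundary_mass \is a fin_num.
Proof.
rewrite /boundary_mass (esum_boundary (fun x y => coupling_ge0 alpha (x - y))).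
apply/sum_fin_numP => x _ _.
exact: rsummable_fin_num (fun y _ => coupling_ge0 _ _) (rsummable_coupling x).
Qed.

Lemma boundary_energy_glue xi zeta : boundary_energy (Defs.glue xi zeta) =
  (\sum_(x : L) \esum_(y in ~` [set` L])
    (J (val x - y) * `|xi x - phi_at y zeta|%:~R)%:E)%E.
Proof.
rewrite /boundary_energy.
rewrite (@esum_boundary (fun x y => J (x - y) *
  `|phi_at x (Defs.glue xi zeta) - phi_at y (Defs.glue xi zeta)|%:~R)); last first.
  by move=> x y; rewrite mulr_ge0 ?coupling_ge0 ?ler0z.
apply: eq_bigr => x _; apply: eq_esum => y /= /negP yL.
by congr (_ * `|_ - _|%:~R)%:E; [exact: phi_at_glue_in|exact: phi_at_glue_out].
Qed.

Lemma boundary_energy_glue_fin_num xi zeta :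
  boundary_energy (Defs.glue xi zeta) \is a fin_num.
Proof.
rewrite boundary_energy_glue; apply/sum_fin_numP => x _ _.
apply: rsummable_fin_num (rsummable_boundary x zeta (xi x)) => y _.
by rewrite mulr_ge0 ?coupling_ge0 ?ler0z.
Qed.

(** Differences inside the box do not change and the field term is linear, so only boundary pairs
    need an estimate. The prefactor [1/2] of the energy turns [1 + 2 |c - zeta|] into the halved
    mass and the full boundary energy. *)
Lemma hamiltonian_raise (s : int) xi zeta : s ^+ 2 = 1 ->
  hamiltonian lambda eta (raise s xi) zeta <=
  hamiltonian lambda eta xi zeta + fine (boundary_energy (Defs.glue xi zeta)) +
  fine boundary_mass / 2 - lambda * s%:~R * \sum_(x : L) eta_at (val x) eta.
Proof.
move=> s2; rewrite /hamiltonian.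
have -> : \sum_(x : L) \sum_(y : L | val x < val y)
    coupling alpha (val x - val y) * (raise s xi x - raise s xi y)%:~R ^+ 2 =
  \sum_(x : L) \sum_(y : L | val x < val y)
    coupling alpha (val x - val y) * (xi x - xi y)%:~R ^+ 2.
  apply: eq_bigr => x _; apply: eq_bigr => y _; rewrite !ffunE.
  by congr (_ * _%:~R ^+ 2); lia.
have -> : \sum_(x : L) eta_at (val x) eta * (raise s xi x)%:~R =
    \sum_(x : L) eta_at (val x) eta * (xi x)%:~R +
    s%:~R * \sum_(x : L) eta_at (val x) eta.
  rewrite mulr_sumr -big_split /=; apply: eq_bigr => x _.
  by rewrite ffunE intrD; ring.
have := @ler_sum R L (index_enum L) xpredT _ _
  (fun x _ => rsum_energy_shift x zeta (xi x) s2).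
under eq_bigr do rewrite -(ffunE (fun x => xi x + s)).
rewrite -/(raise s xi) big_split/= [X in _ + X]big_split/= -mulr_sumr.
have -> : \sum_(x : L) fine (\esum_(y in ~` [set` L]) (J (val x - y))%:E) =
    fine boundary_mass.
  rewrite /boundary_mass (esum_boundary (fun x y => coupling_ge0 alpha (x - y))).
  apply: sum_fine => x _.
  exact: rsummable_fin_num (fun y _ => coupling_ge0 _ _) (rsummable_coupling x).
have -> : \sum_(x : L) fine (\esum_(y in ~` [set` L])
      (J (val x - y) * `|xi x - phi_at y zeta|%:~R)%:E) =
    fine (boundary_energy (Defs.glue xi zeta)).
  rewrite boundary_energy_glue; apply: sum_fine => x _.
  apply: rsummable_fin_num (rsummable_boundary x zeta (xi x)) => y _.
  by rewrite mulr_ge0 ?coupling_ge0 ?ler0z.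
by move: (\sum_(x : L) rsum _ _) => u; move: (\sum_(x : L) rsum _ _) => w; nra.
Qed.

End energy.

(** * Averages under the finite-volume measure *)

Section gibbs_kernel.
Context {R : realType} {alpha : \bar R}.
Variables (lambda beta : R) (eta : disorder R) (L : {fset int}).
Implicit Types (xi : {ffun L -> int}) (zeta phi : Omega alpha).
Local Notation J := (coupling alpha).
Local Notation gamma xi zeta := (gamma lambda beta eta xi zeta).

Let Z zeta : \bar R :=
  \esum_(xi in [set: {ffun L -> int}]) (boltzmann lambda beta eta xi zeta)%:E.

Let gammaZ xi zeta : gamma xi zeta = boltzmann lambda beta eta xi zeta / fine (Z zeta).
Proof. by rewrite /Defs.gamma rsum_ge0// => ? _; exact: expR_ge0. Qed.

Lemma gamma_ge0 xi zeta : 0 <= gamma xi zeta.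
Proof.
rewrite gammaZ divr_ge0 ?expR_ge0// fine_ge0// esum_ge0// => ? _.
by rewrite lee_fin expR_ge0.
Qed.

Definition gamma_mass zeta : \bar R :=
  \esum_(xi in [set: {ffun L -> int}]) (gamma xi zeta)%:E.

(** An infinite partition function is sent to 0 by [fine], and its inverse is 0 by convention; the
    mass is then 0. In the finite case it is a quotient of equal numbers. *)
Lemma gamma_mass_le1 zeta : (gamma_mass zeta <= 1)%E.
Proof.
rewrite /gamma_mass; under eq_esum do rewrite gammaZ EFinM.
have Z0 : (0 <= Z zeta)%E by apply: esum_ge0 => ? _; rewrite lee_fin expR_ge0.
rewrite esumZr; [|by rewrite invr_ge0 fine_ge0|by move=> ?; rewrite lee_fin expR_ge0].
rewrite -/(Z zeta); case: (Z zeta) Z0 => [r||] //= r0.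
  rewrite -EFinM lee_fin; have [->|rN0] := eqVneq r 0; first by rewrite mul0r.
  by rewrite divff.
by rewrite invr0 mule0.
Qed.

Lemma gamma_mass_ge0 zeta : (0 <= gamma_mass zeta)%E.
Proof. by apply: esum_ge0 => xi _; rewrite lee_fin gamma_ge0. Qed.

Lemma measurable_gamma xi : measurable_fun [set: Omega alpha] (fun zeta => gamma xi zeta).
Proof.
have mB xi' : measurable_fun [set: Omega alpha]
    (fun zeta => boltzmann lambda beta eta xi' zeta).
  apply: (@measurableT_comp _ _ _ _ _ _ expR) => //.
  apply: measurable_funM => //; apply: measurable_funB => //.
  apply: measurable_funD => //; apply: measurable_funM => //.
  apply: measurable_sum => x; apply: measurable_rsum => y.
  exact: (measurable_coord (fun b => J (val x - y) *
    ((xi' x - b)%:~R ^+ 2 - b%:~R ^+ 2))).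
apply: measurable_funM => //.
(* The inverse is written as the power [-1], a measurable function, which agrees with it on
   nonnegative numbers. *)
rewrite (_ : (fun zeta => _) = (fun zeta =>
    rsum [set: {ffun L -> int}] (fun xi' => boltzmann lambda beta eta xi' zeta) `^ (-1))).
  apply: (@measurableT_comp _ _ _ _ _ _ (fun x => x `^ (-1))) => //.
  exact: (@measurable_rsum _ _ _ {ffun L -> int} setT
    (fun xi zeta => boltzmann lambda beta eta xi zeta)).
apply/funext => zeta; rewrite powR_inv1// rsum_ge0; last by move=> ? _; exact: expR_ge0.
by rewrite fine_ge0// esum_ge0// => ? _; rewrite lee_fin expR_ge0.
Qed.

(* [gammaE] for functions with values in [0, +oo]. *)
Definition gamma_mean (F : Omega alpha -> \bar R) zeta : \bar R :=
  \esum_(xi in [set: {ffun L -> int}]) ((gamma xi zeta)%:E * F (Defs.glue xi zeta))%E.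

(** Boundedness and mass at most 1 make the sum finite, so [fine] inside [rsum] loses nothing. *)
Lemma gammaE_mean (f : Omega alpha -> R) (M : R) zeta : (forall phi, 0 <= f phi <= M) ->
  (gammaE lambda beta eta L f zeta)%:E = gamma_mean (EFin \o f) zeta.
Proof.
move=> fM.
have f0 phi : 0 <= f phi by have /andP[] := fM phi.
have M0 : 0 <= M by have /andP[/le_trans h /h] := fM zeta.
rewrite /gammaE rsum_ge0; last by move=> xi _; rewrite mulr_ge0 ?gamma_ge0.
have -> : gamma_mean (EFin \o f) zeta =
    \esum_(xi in [set: {ffun L -> int}]) (gamma xi zeta * f (Defs.glue xi zeta))%:E.
  by apply: eq_esum => xi _; rewrite EFinM.
rewrite fineK// ge0_fin_numE; last first.
  by apply: esum_ge0 => xi _; rewrite lee_fin mulr_ge0 ?gamma_ge0.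
apply: (@le_lt_trans _ _ (gamma_mass zeta * M%:E)%E); last first.
  apply: (@le_lt_trans _ _ (1 * M%:E)%E); last by rewrite mul1e ltry.
  by apply: lee_wpmul2r; rewrite ?lee_fin// gamma_mass_le1.
rewrite -esumZr//; last by move=> xi; rewrite lee_fin gamma_ge0.
apply: le_esum => xi _; rewrite -EFinM lee_fin ler_wpM2l ?gamma_ge0//.
by have /andP[] := fM (Defs.glue xi zeta).
Qed.

Lemma gamma_mean_esum (T : countType) (D : set T) (f : T -> Omega alpha -> R) zeta :
  (forall t phi, 0 <= f t phi) ->
  gamma_mean (fun phi => \esum_(t in D) (f t phi)%:E) zeta =
  \esum_(t in D) gamma_mean (EFin \o f t) zeta.
Proof.
move=> f0; rewrite /gamma_mean.
rewrite [RHS]esum_exchange; last first.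
  by move=> t xi; rewrite mule_ge0 ?lee_fin ?gamma_ge0//; exact: f0.
apply: eq_esum => xi _; rewrite -esumZl ?gamma_ge0// => t.
by rewrite lee_fin.
Qed.

Lemma measurable_gamma_mean (F : Omega alpha -> \bar R) :
  measurable_fun [set: Omega alpha] F -> (forall phi, 0 <= F phi)%E ->
  measurable_fun [set: Omega alpha] (gamma_mean F).
Proof.
move=> mF F0; apply: measurable_esum => [xi zeta|xi].
  by rewrite mule_ge0// lee_fin gamma_ge0.
apply: emeasurable_funM; first by apply/measurable_EFinP; exact: measurable_gamma.
exact: (measurableT_comp mF (measurable_glue xi)).
Qed.

(** By the assumption on [r], raising by [s] changes the energy by at most [G - r]. Comparing the
    weights before and after the raise and summing over all configurations makes the two masses
    cancel. *)
Lemma gamma_mean_boundary_energy (s : int) (r : R) zeta :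
  (\esum_(k in [set k : int | k != 0%R]) (J k)%:E < +oo)%E ->
  0 < beta -> s ^+ 2 = 1 -> 0 <= r ->
  r + fine (@boundary_mass _ alpha L) / 2 <=
    lambda * s%:~R * \sum_(x : L) eta_at (val x) eta ->
  (r%:E * gamma_mass zeta <= gamma_mean (boundary_energy L) zeta)%E.
Proof.
move=> J_lty b0 s2 r0 hr.
pose G xi : R := fine (boundary_energy L (Defs.glue xi zeta)).
have Gfin xi := boundary_energy_glue_fin_num J_lty xi zeta.
have G0 xi : 0 <= G xi.
  rewrite fine_ge0// esum_ge0// => p _.
  by rewrite lee_fin mulr_ge0 ?coupling_ge0 ?ler0z.
(* This is [1 + x <= exp x] at [x = beta * (r - G)], with the [G] term moved to the right so that
   both sides are nonnegative and can be summed. *)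
have step xi : (1 + beta * r) * gamma xi zeta <=
    gamma (raise s xi) zeta + beta * (gamma xi zeta * G xi).
  rewrite !gammaZ; set z := (fine (Z zeta))^-1.
  have z0 : 0 <= z.
    by rewrite invr_ge0 fine_ge0// esum_ge0// => ? _; rewrite lee_fin expR_ge0.
  have hH := hamiltonian_raise lambda eta J_lty xi zeta s2.
  rewrite -/(G xi) in hH.
  have bb : boltzmann lambda beta eta (raise s xi) zeta >=
      boltzmann lambda beta eta xi zeta * (1 + beta * (r - G xi)).
    apply: (@le_trans _ _ (boltzmann lambda beta eta xi zeta * expR (beta * (r - G xi)))).
      by rewrite ler_wpM2l ?expR_ge0// expR_ge1Dx.
    rewrite /boltzmann -expRD ler_expR; nra.
  have := ler_wpM2r z0 bb; nra.
have bij : set_bij [set: {ffun L -> int}] [set: {ffun L -> int}] (raise s).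
  split => //.
    move=> x y _ _ /ffunP xy; apply/ffunP => i; have := xy i.
    by rewrite !ffunE => /addIr.
  move=> y _; exists (raise (- s) y) => //.
  by apply/ffunP => i; rewrite !ffunE subrK.
(* The raise permutes the configurations, so the raised weights again sum to [gamma_mass]. *)
have sumstep : ((1 + beta * r)%:E * gamma_mass zeta <=
    gamma_mass zeta + beta%:E * gamma_mean (boundary_energy L) zeta)%E.
  rewrite -esumZl; [|by rewrite addr_ge0// mulr_ge0// ltW|
    by move=> xi; rewrite lee_fin gamma_ge0].
  rewrite [X in (_ <= X + _)%E](_ : _ =
    \esum_(xi in [set: {ffun L -> int}]) (gamma (raise s xi) zeta)%:E); last first.
    by rewrite /gamma_mass (reindex_esum _ _ _ _ bij).
  have -> : gamma_mean (boundary_energy L) zeta =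
      \esum_(xi in [set: {ffun L -> int}]) (gamma xi zeta * G xi)%:E.
    by apply: eq_esum => xi _; rewrite -[in LHS](fineK (Gfin xi)).
  rewrite -esumZl; [|exact: ltW|by move=> xi; rewrite lee_fin mulr_ge0 ?gamma_ge0].
  rewrite -esumD; [|by move=> xi _; rewrite lee_fin gamma_ge0|
    by move=> xi _; rewrite -EFinM lee_fin mulr_ge0 ?(ltW b0)// mulr_ge0 ?gamma_ge0].
  by apply: le_esum => xi _; rewrite -!EFinM -EFinD lee_fin.
(* Finiteness of the mass is what allows it to be cancelled; afterwards [beta] is divided out. *)
have mfin : gamma_mass zeta \is a fin_num.
  by rewrite ge0_fin_numE ?gamma_mass_ge0// (le_lt_trans (gamma_mass_le1 _))// ltry.
move: sumstep; rewrite -(fineK mfin).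
case: (gamma_mean _ _) => [g||].
- rewrite -!EFinM -EFinD !lee_fin => h; rewrite -(ler_pM2l b0); nra.
- by move=> _; rewrite leey.
- by rewrite gt0_muleNy// addeNy -EFinM leeNy_eq.
Qed.

End gibbs_kernel.

(** * The DLR equations for the boundary energy *)

Section dlr_boundary.
Context {R : realType} {alpha : \bar R}.
Local Notation J := (coupling alpha).

Lemma esum_ltn (n : nat) :
  (\esum_(k in [set: nat]) ((k < n)%N%:R : R)%:E = (n%:R)%:E)%E.
Proof.
transitivity (\esum_(k in `I_n) (1%:E : \bar R)).
  rewrite [RHS]esum_mkcond; apply: eq_esum => k _.
  by have [kn|kn] := ltnP k n; [rewrite mem_set|rewrite memNset//= ltnNge kn].
rewrite esum_fset// -(fsbig_ord _ n (fun=> 1%:E : \bar R)) sumEFin; congr _%:E.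
by rewrite sumr_const card_ord.
Qed.

(** Layer-cake decomposition: [|a - b|] is the number of naturals [k] below it. Each layer is
    bounded and depends on two sites only, hence is admissible in the DLR equations. *)
Definition layer (t : int * int * nat) (phi : Omega alpha) : R :=
  J (t.1.1 - t.1.2) * (t.2 < `|phi_at t.1.1 phi - phi_at t.1.2 phi|)%N%:R.

Lemma layer_bounds t phi : 0 <= layer t phi <= J (t.1.1 - t.1.2).
Proof.
have J0 := coupling_ge0 alpha (t.1.1 - t.1.2).
by rewrite /layer; case: ltnP => _; rewrite ?mulr1 ?mulr0 ?J0 ?lexx.
Qed.

Lemma measurable_layer t : measurable_fun [set: Omega alpha] (layer t).
Proof.
exact: (measurable_coord2 (fun a b => J (t.1.1 - t.1.2) * (t.2 < `|a - b|)%N%:R)).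
Qed.

Lemma bounded_layer t : bounded_fun (layer t).
Proof.
exists (J (t.1.1 - t.1.2)); split; first exact: num_real.
move=> M JM phi _; have /andP[l0 lJ] := layer_bounds t phi.
by rewrite /= ger0_norm// (le_trans lJ)// ltW.
Qed.

Lemma local_layer t : local_fun (layer t).
Proof.
exists [fset t.1.1; t.1.2]%fset => phi psi h.
by rewrite /layer !h// !inE eqxx ?orbT.
Qed.

Lemma boundary_energy_layers (L : {fset int}) (phi : Omega alpha) :
  boundary_energy L phi =
  \esum_(t in [set t | boundary L t.1]) (layer t phi)%:E.
Proof.
have -> : [set t : int * int * nat | boundary L t.1] = boundary L `*`` (fun=> setT).
  by apply/seteqP; split => -[p k] //= [].
have l0 t : 0 <= layer t phi by have /andP[] := layer_bounds t phi.
rewrite -(@esum_esum _ _ _ _ _ (fun p k => (layer (p, k) phi)%:E))//; last first.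
  by move=> p k; rewrite lee_fin.
apply: eq_esum => p _; rewrite /layer /=.
under [RHS]eq_esum do rewrite EFinM.
rewrite esumZl ?coupling_ge0// esum_ltn -EFinM; congr (_ * _)%:E.
Qed.

Lemma measurable_boundary_energy (L : {fset int}) :
  measurable_fun [set: Omega alpha] (boundary_energy L).
Proof.
apply: measurable_esum => [p phi|p].
  by rewrite lee_fin mulr_ge0 ?coupling_ge0 ?ler0z.
apply/measurable_EFinP.
exact: (measurable_coord2 (fun a b => J (p.1 - p.2) * `|a - b|%:~R)).
Qed.

Lemma boundary_energy_ge0 (L : {fset int}) (phi : Omega alpha) :
  (0 <= boundary_energy L phi)%E.
Proof.
by apply: esum_ge0 => p _; rewrite lee_fin mulr_ge0 ?coupling_ge0 ?ler0z.
Qed.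

(** Integrating the kernel inequality against [m] leaves [r] on the left, as the mass has mean 1. On
    the right it gives the mean of [G], by DLR applied layer by layer. *)
Lemma dlr_boundary_energy (lambda beta : R) (eta : disorder R) (L : {fset int})
    (m : probability (Omega alpha) R) (s : int) (r : R) :
  (forall f : Omega alpha -> R, measurable_fun [set: Omega alpha] f ->
    bounded_fun f -> local_fun f ->
    (\int[m]_phi (f phi)%:E = \int[m]_phi (gammaE lambda beta eta L f phi)%:E)%E) ->
  (\esum_(k in [set k : int | k != 0%R]) (J k)%:E < +oo)%E ->
  0 < beta -> s ^+ 2 = 1 -> 0 <= r ->
  r + fine (@boundary_mass _ alpha L) / 2 <=
    lambda * s%:~R * \sum_(x : L) eta_at (val x) eta ->
  (r%:E <= \int[m]_phi boundary_energy L phi)%E.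
Proof.
move=> dlr J_lty b0 s2 r0 hr.
have mmean (f : Omega alpha -> R) (M : R) : measurable_fun [set: Omega alpha] f ->
    (forall phi, 0 <= f phi <= M) ->
    measurable_fun [set: Omega alpha] (gamma_mean lambda beta eta L (EFin \o f)).
  move=> mf fM; apply: measurable_gamma_mean; first exact/measurable_EFinP.
  by move=> phi; rewrite lee_fin; have /andP[] := fM phi.
have mean0 F : (forall phi : Omega alpha, 0 <= F phi)%E ->
    forall zeta, (0 <= gamma_mean lambda beta eta L F zeta)%E.
  by move=> F0 zeta; apply: esum_ge0 => xi _; rewrite mule_ge0// lee_fin gamma_ge0.
have l0 t phi : 0 <= layer t phi by have /andP[] := layer_bounds t phi.
have -> : (\int[m]_phi boundary_energy L phi =
    \int[m]_phi gamma_mean lambda beta eta L (boundary_energy L) phi)%E.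
  under eq_integral => phi _ do rewrite boundary_energy_layers.
  rewrite integral_esum; [|by move=> t phi; rewrite lee_fin|
    by move=> t; apply/measurable_EFinP; exact: measurable_layer].
  have -> : boundary_energy L =
      (fun phi : Omega alpha => \esum_(t in [set t | boundary L t.1]) (layer t phi)%:E).
    by apply/funext => phi; exact: boundary_energy_layers.
  under [RHS]eq_integral => phi _ do rewrite gamma_mean_esum//.
  rewrite integral_esum; last 2 first.
  - by move=> t phi; apply: mean0 => psi; rewrite lee_fin.
  - by move=> t; apply: mmean (layer_bounds t); exact: measurable_layer.
  apply: eq_esum => t _.
  rewrite dlr; [|exact: measurable_layer|exact: bounded_layer|exact: local_layer].
  by apply: eq_integral => phi _; rewrite (@gammaE_mean _ _ _ _ _ _ _ _ _ (layer_bounds t)).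
(* DLR for the constant function 1. As the mass is at most 1, a mean of 1 rules out the default
   value 0 outside an [m]-null set. *)
have mass1 : (\int[m]_phi gamma_mass lambda beta eta L phi = 1)%E.
  have one01 (phi : Omega alpha) : 0 <= (cst 1 phi : R) <= 1 by rewrite /= ler01 lexx.
  transitivity (\int[m]_phi (gammaE lambda beta eta L (cst 1) phi)%:E)%E.
    apply: eq_integral => phi _; rewrite (@gammaE_mean _ _ _ _ _ _ _ _ _ one01).
    by apply: eq_esum => xi _; rewrite mule1.
  rewrite -dlr.
  - transitivity (\int[m]_phi (cst 1%:E phi))%E; first by [].
    by rewrite integral_cst//= mul1e; exact: (@probability_setT _ _ _ m).
  - exact: measurable_cst.
  - by exists 1; split => // M M1 phi _; rewrite /= normr1 ltW.
  - by exists fset0.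
have mmass : measurable_fun [set: Omega alpha] (gamma_mass lambda beta eta L).
  apply: measurable_esum => [xi phi|xi]; first by rewrite lee_fin gamma_ge0.
  by apply/measurable_EFinP; exact: measurable_gamma.
rewrite -[X in (X <= _)%E]mule1 -mass1 -ge0_integralZl//; last first.
  by move=> phi _; exact: gamma_mass_ge0.
apply: ge0_le_integral => //.
- by move=> phi _; rewrite mule_ge0 ?lee_fin// gamma_mass_ge0.
- exact: measurable_funeM.
- by apply: measurable_gamma_mean;
    [exact: measurable_boundary_energy|exact: boundary_energy_ge0].
- by move=> phi _; apply: gamma_mean_boundary_energy hr.
Qed.

End dlr_boundary.

(** * Averaging over the disorder *)

Section annealed.
Context {R : realType} {alpha : \bar R}.
Variables (P : probability (disorder R) R)
  (mu : disorder R -> pprobability (Omega alpha) R).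
Hypotheses (hP : iid_disorder P) (mmu : measurable_fun [set: disorder R] mu).

Lemma measurable_quenched (F : Omega alpha -> \bar R) :
  measurable_fun [set: Omega alpha] F -> (forall phi, 0 <= F phi)%E ->
  measurable_fun [set: disorder R] (fun eta => \int[mu eta]_phi F phi)%E.
Proof.
move=> mF F0.
apply: (@measurable_fun_integral_kernel _ _ _ _ _ (kprobability mmu)) => // U mU.
exact: measurable_kernel.
Qed.

(** By covariance the quenched moment at [x] is, almost surely, the one at 0 for the disorder
    [theta x eta]; the law of the disorder is invariant under [theta x]. *)
Lemma annealed_first_moment_shift x : shift_covariant P mu ->
  (\int[P]_eta \int[mu eta]_phi (`|phi_at x phi|%:~R)%:E =
   \int[P]_eta \int[mu eta]_phi (`|phi_at 0 phi|%:~R)%:E)%E.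
Proof.
move=> /(_ x) hx.
have mabs y : measurable_fun [set: Omega alpha] (fun phi => (`|phi_at y phi|%:~R : R)%:E).
  exact: (measurable_coord (fun b : int => (`|b|%:~R : R)%:E)).
have abs0 y (phi : Omega alpha) : (0 <= (`|phi_at y phi|%:~R : R)%:E)%E.
  by rewrite lee_fin ler0z.
have mq y := measurable_quenched (mabs y) (abs0 y).
have q0 y e : (0 <= \int[mu e]_phi (`|phi_at y phi|%:~R)%:E)%E by exact: integral_ge0.
rewrite -[RHS](ge0_integral_theta hP x (mq 0) (q0 0)).
apply: ge0_ae_eq_integral => //.
  exact: (measurableT_comp (mq 0) (measurable_theta x)).
apply: filterS hx => eta hx _.
transitivity (\int[pushforward (mu eta) (tau x)]_phi (`|phi_at 0 phi|%:~R)%:E)%E.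
  rewrite ge0_integral_pushforward//; first by rewrite preimage_setT /phi_at /= add0r.
  exact: measurable_tau.
apply: eq_measure_integral; first exact: measurable_tau.
by move=> mt A mA _; apply/esym; exact: hx.
Qed.

(** The triangle inequality [|phi x - phi y| <= |phi x| + |phi y|] costs one annealed moment [M] for
    each end of a boundary pair. *)
Lemma annealed_boundary_energy_le (L : {fset int}) (M : R) :
  shift_covariant P mu ->
  (\int[P]_eta \int[mu eta]_phi (`|phi_at 0 phi|%:~R)%:E = M%:E)%E ->
  (\int[P]_eta \int[mu eta]_phi boundary_energy L phi <=
   boundary_mass (alpha := alpha) L * (M + M)%:E)%E.
Proof.
move=> hcov hM.
pose J := coupling alpha.
pose a (p : int * int) (phi : Omega alpha) : R :=
  J (p.1 - p.2) * `|phi_at p.1 phi - phi_at p.2 phi|%:~R.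
have a0 p phi : (0 <= (a p phi)%:E)%E by rewrite lee_fin mulr_ge0 ?coupling_ge0 ?ler0z.
have ma p : measurable_fun [set: Omega alpha] (fun phi => (a p phi)%:E).
  apply/measurable_EFinP.
  exact: (measurable_coord2 (fun b c => J (p.1 - p.2) * `|b - c|%:~R)).
have mabs y : measurable_fun [set: Omega alpha] (fun phi => (`|phi_at y phi|%:~R : R)%:E).
  exact: (measurable_coord (fun b : int => (`|b|%:~R : R)%:E)).
have abs0 y (phi : Omega alpha) : (0 <= (`|phi_at y phi|%:~R : R)%:E)%E.
  by rewrite lee_fin ler0z.
have M0 : 0 <= M.
  by rewrite -lee_fin -hM; apply: integral_ge0 => e _; exact: integral_ge0.
under eq_integral => eta _ do rewrite (integral_esum _ a0 ma).
rewrite integral_esum; last 2 first.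
- by move=> p eta; exact: integral_ge0.
- by move=> p; exact: measurable_quenched.
rewrite /boundary_mass -esumZr; [|exact: addr_ge0|by move=> p; rewrite lee_fin coupling_ge0].
apply: le_esum => p _.
have J0 : 0 <= J (p.1 - p.2) := coupling_ge0 _ _.
have mD : measurable_fun [set: Omega alpha] (fun phi =>
    (`|phi_at p.1 phi|%:~R : R)%:E + (`|phi_at p.2 phi|%:~R)%:E)%E.
  exact: emeasurable_funD.
have D0 (phi : Omega alpha) :
    (0 <= (`|phi_at p.1 phi|%:~R : R)%:E + (`|phi_at p.2 phi|%:~R)%:E)%E.
  by rewrite adde_ge0.
apply: (@le_trans _ _ (\int[P]_eta ((J (p.1 - p.2))%:E * \int[mu eta]_phi
    ((`|phi_at p.1 phi|%:~R : R)%:E + (`|phi_at p.2 phi|%:~R)%:E)))%E).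
  apply: ge0_le_integral => //.
  - by move=> eta _; exact: integral_ge0.
  - exact: measurable_quenched.
  - by apply: measurable_funeM; exact: measurable_quenched.
  - move=> eta _; rewrite -ge0_integralZl//.
    apply: ge0_le_integral => //; first exact: measurable_funeM.
    move=> phi _; rewrite -EFinD -EFinM lee_fin ler_wpM2l//.
    by rewrite -intrD ler_int ler_normB.
rewrite ge0_integralZl//; last 2 first.
- exact: measurable_quenched.
- by move=> eta _; exact: integral_ge0.
apply: lee_wpmul2l; first by rewrite lee_fin.
under eq_integral => eta _ do rewrite ge0_integralD//.
rewrite ge0_integralD//; try by [move=> eta _; exact: integral_ge0|exact: measurable_quenched].
by rewrite !annealed_first_moment_shift// hM.
Qed.

End annealed.

(** * Comparison of the growth rates *)

Lemma sum_box {R : realType} (n : nat) (eta : disorder R) :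
  \sum_(x : box n) eta_at (val x) eta = partial_sum n eta.
Proof.
rewrite -(big_seq_fsetE _ (box n) xpredT (fun x => eta_at x eta))/=.
rewrite big_imfset/=; last by move=> ? ? _ _ [].
by rewrite /partial_sum -(big_mkord xpredT (fun i => eta_at (Posz i) eta))
  /index_iota subn0 undup_id ?iota_uniq.
Qed.

Lemma sqrt_le_powR_absurd {R : realType} (K theta : R) : 1 / 2 < theta ->
  ~ (forall n, (0 < n)%N -> Num.sqrt n%:R <= K * n%:R `^ (1 - theta)).
Proof.
move=> ht h; pose d := theta - 1 / 2.
have d0 : 0 < d by rewrite /d; lra.
have K0 : 0 <= K.
  by move: (h 1%N isT) => /(le_trans (sqrtr_ge0 _)); rewrite powR1 mulr1.
(* Any [n] with [n^d > K] contradicts the bound, since [d + (1 - theta) = 1/2]. *)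
pose n := (Num.truncn (K `^ d^-1)).+1.
have nK : K `^ d^-1 < n%:R by rewrite /n truncnS_gt.
have : K < n%:R `^ d.
  have {1}-> : K = (K `^ d^-1) `^ d by rewrite -powRrM mulVf ?lt0r_neq0// powRr1.
  by apply: gt0_ltr_powR; rewrite ?nnegrE ?powR_ge0 ?ler0n.
apply/negP; rewrite -leNgt.
have p0 : 0 < n%:R `^ (1 - theta) :> R by rewrite powR_gt0 ?ltr0n.
rewrite -(ler_pM2r p0); apply: le_trans (h n isT).
rewrite -powRD ?pnatr_eq0 ?implybT// -powR12_sqrt ?ler0n//.
by have -> : d + (1 - theta) = 2^-1 by rewrite /d; lra.
Qed.

Theorem theorem1p3 (R : realType) (alpha : \bar R) (lambda beta : R)
    (P : probability (disorder R) R)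
    (halpha : ((3 / 2)%:E < alpha)%E) (hlambda : 0 < lambda) (hbeta : 0 < beta)
    (hP : iid_disorder P) :
  ~ exists mu : disorder R -> pprobability (Omega alpha) R,
      [/\ measurable_fun [set: disorder R] mu,
          shift_covariant_gibbs lambda beta P mu &
          finite_annealed_first_moment P mu].
Proof.
move=> [mu [mmu [hdlr hcov] hfin]].
have [theta /andP[ht1 ht2] htheta] := coupling_weighted_lty halpha.
have ht0 : 0 <= theta by lra.
have J_lty := coupling_lty ht0 htheta.
have [c c0 hc] := partial_sum_lower_bound hP.
pose A : R := fine (\esum_(k in [set k : int | k != 0%R])
  (coupling alpha k * (`|k|%N)%:R `^ theta)%:E)%E.
pose M : R := fine (\int[P]_eta \int[mu eta]_phi (`|phi_at 0 phi|%:~R)%:E)%E.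
have hM : (\int[P]_eta \int[mu eta]_phi (`|phi_at 0 phi|%:~R)%:E = M%:E)%E.
  rewrite fineK// ge0_fin_numE//; apply: integral_ge0 => eta _.
  by apply: integral_ge0 => phi _; rewrite lee_fin ler0z.
have M0 : 0 <= M.
  rewrite -lee_fin -hM; apply: integral_ge0 => eta _.
  by apply: integral_ge0 => phi _; rewrite lee_fin ler0z.
pose mass n : R := fine (@boundary_mass R alpha (box n)).
have massE n : (@boundary_mass R alpha (box n)) = (mass n)%:E.
  by rewrite fineK//; exact: boundary_mass_fin_num.
have mass0 n : 0 <= mass n.
  by rewrite fine_ge0// esum_ge0// => p _; rewrite lee_fin coupling_ge0.
have mass_le n : (0 < n)%N -> mass n <= A * n%:R `^ (1 - theta).
  move=> n0; rewrite -lee_fin -massE EFinM fineK.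
    by apply: boundary_coupling_le => //; rewrite ht0.
  rewrite ge0_fin_numE//; apply: esum_ge0 => k _.
  by rewrite lee_fin mulr_ge0 ?coupling_ge0 ?powR_ge0.
have quenched n : {ae P, forall eta,
    ((lambda * `|partial_sum n eta|)%:E <=
     \int[mu eta]_phi boundary_energy (box n) phi + (mass n / 2)%:E)%E}.
  apply: filterS hdlr => eta /(_ (box n)) dlr.
  have b0 : (0 <= \int[mu eta]_phi boundary_energy (box n) phi)%E.
    by apply: integral_ge0 => phi _; exact: boundary_energy_ge0.
  (* If [lambda * |S|] is below half the boundary mass, nonnegativity of the boundary energy already
     gives the claim; otherwise the difference serves as [r]. *)
  have [r0|r0] := leP 0 (lambda * `|partial_sum n eta| - mass n / 2); last first.
    apply: (@le_trans _ _ (0 + (mass n / 2)%:E)%E); last exact: leeD2r.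
    by rewrite add0e lee_fin; lra.
  rewrite -leeBlDr// -EFinB.
  (* Raising in the direction of the sign of the disorder sum turns [s * S] into [|S|]. *)
  pose s : int := if 0 <= partial_sum n eta then 1 else -1.
  apply: (@dlr_boundary_energy R alpha lambda beta eta (box n) (mu eta) s) => //.
    by rewrite /s; case: ifP.
  rewrite sum_box -/(mass n) subrK -mulrA; apply: ler_wpM2l; first exact: ltW.
  rewrite /s; case: (lerP 0 (partial_sum n eta)) => S0.
    by rewrite mulr1z mul1r ?ger0_norm.
  by rewrite mulrN1z mulN1r ?ltr0_norm.
have mS n : measurable_fun [set: disorder R] (@partial_sum R n).
  by apply: measurable_sum => i; exact: measurable_eta_at.
have mq n : measurable_fun [set: disorder R]
    (fun eta => \int[mu eta]_phi boundary_energy (box n) phi)%E.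
  apply: measurable_quenched => //; first exact: measurable_boundary_energy.
  exact: boundary_energy_ge0.
have q0 n eta : (0 <= \int[mu eta]_phi boundary_energy (box n) phi)%E.
  by apply: integral_ge0 => phi _; exact: boundary_energy_ge0.
have h0 n : 0 <= mass n / 2 by rewrite divr_ge0.
(* The [M + M] comes from the two ends of a boundary pair, the [1/2] from the halved boundary
   mass. *)
have key n : (0 < n)%N -> lambda * (c * Num.sqrt n%:R) <= (M + M + 1 / 2) * mass n.
  move=> n0; rewrite -lee_fin.
  apply: (@le_trans _ _ (\int[P]_eta (lambda * `|partial_sum n eta|)%:E)%E).
    under eq_integral => eta _ do rewrite EFinM.
    rewrite ge0_integralZl//; last 2 first.
    - by apply/measurable_EFinP; exact: measurableT_comp.
    - by rewrite lee_fin ltW.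
    by rewrite EFinM; apply: lee_wpmul2l; [rewrite lee_fin ltW|exact: hc].
  apply: (@le_trans _ _ (\int[P]_eta
      (\int[mu eta]_phi boundary_energy (box n) phi + (mass n / 2)%:E))%E).
    apply: ae_ge0_le_integral => //.
    - by move=> eta _; rewrite lee_fin mulr_ge0// ltW.
    - apply/measurable_EFinP; apply: measurable_funM => //.
      exact: measurableT_comp.
    - by move=> eta _; rewrite adde_ge0// lee_fin.
    - exact: emeasurable_funD.
    - by apply: filterS (quenched n).
  rewrite ge0_integralD//; last by move=> eta _; rewrite lee_fin.
  rewrite integral_cst//= probability_setT mule1.
  apply: (@le_trans _ _ (mass n * (M + M) + mass n / 2)%:E); last first.
    by rewrite lee_fin; lra.
  rewrite EFinD; apply: leeD2r; rewrite EFinM -massE.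
  exact: annealed_boundary_energy_le.
apply: (@sqrt_le_powR_absurd R ((M + M + 1 / 2) * A / (lambda * c)) theta) => // n n0.
rewrite mulrAC ler_pdivlMr ?mulr_gt0// mulrC -mulrA.
apply: (le_trans (key n n0)); rewrite -mulrA ler_wpM2l ?mass_le//.
by rewrite !addr_ge0// divr_ge0.
Qed.
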